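(* Let $m_1\ge m_2\ge1$, $\varepsilon>0$, $T>0$, $\kappa\ge 3m_2+1$, and $U_0\in\mathcal X_{m_2}$. Then there exists a unique $U\in C([0,T];\mathcal X_{m_2})$ such that for all $t\in[0,T]$ $$U(t)=e^{t\mathcal L_\kappa}U_0+\int_0^t e^{(t-s)\mathcal L_\kappa}\mathcal N[U(s)]\,\mathrm ds,$$ i.e. the (mild) solution of $U_t=\varepsilon^2\Delta U+f(U)$, $U(0)=U_0$, with periodic boundary conditions. In particular $\|U(t,\boldsymbol x)\|_{\rm F}\le\sqrt{m_2}$ for all $(t,\boldsymbol x)\in[0,T]\times\Omega$.
   Context: Let $d\in\{1,2,3\}$ and let $\Omega\subset\mathbb{R}^d$ be a rectangular box, all functions on $\Omega$ being $\Omega$-periodic (periodic boundary conditions). Let $m_1\ge m_2\ge1$ be integers, $\varepsilon>0$, $\kappa>0$. $\|\cdot\|_{\rm F}$ is the Frobenius norm. For $U\in\mathbb{R}^{m_1\times m_2}$, $f(U)=U-UU^\top U$ and $\mathcal N[U]=\kappa U+f(U)$ (applied pointwise to functions). $\mathcal X$ is the Banach space of continuous $\Omega$-periodic functions $\overline\Omega\to\mathbb{R}^{m_1\times m_2}$ with norm $\|W\|_{\mathcal X}=\max_{\boldsymbol x\in\overline\Omega}\|W(\boldsymbol x)\|_{\rm F}$, and $\mathcal X_{m_2}=\{W\in\mathcal X:\|W\|_{\mathcal X}\le\sqrt{m_2}\}$. $\mathcal L_\kappa=\varepsilon^2\Delta-\kappa\mathcal I$ with periodic boundary conditions, acting componentwise,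 and $e^{t\mathcal L_\kappa}=e^{-\kappa t}e^{t\varepsilon^2\Delta}$, where $e^{t\varepsilon^2\Delta}$ is the periodic heat semigroup. *)

(* Defs.v *)
From HB Require Import structures.
From mathcomp Require Import all_boot all_order all_algebra.
From mathcomp Require Import all_classical all_reals all_analysis.
Set Implicit Arguments. Unset Strict Implicit. Unset Printing Implicit Defensive.
Import Order.TTheory GRing.Theory Num.Theory.
Local Open Scope ring_scope.
Local Open Scope classical_set_scope.

Section Defs.
Variable R : realType.

Fixpoint iint (n : nat) : ('rV[R]_n -> R) -> R :=
  match n return ('rV[R]_n -> R) -> R with
  | 0 => fun F => F 0
  | n'.+1 => fun F =>
      Rintegral (@lebesgue_measure R) setT
        (fun y : R => iint (fun z : 'rV[R]_n' =>
           F (row_mx (y%:M : 'M[R]_(1,1)) z : 'rV[R]_n'.+1)))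
  end.

Definition sqnorm (n : nat) (z : 'rV[R]_n) : R := \sum_i (z 0 i) ^+ 2.

Definition frob (m1 m2 : nat) (A : 'M[R]_(m1, m2)) : R :=
  Num.sqrt (\sum_i \sum_j (A i j) ^+ 2).

Definition fnl (m1 m2 : nat) (A : 'M[R]_(m1, m2)) : 'M[R]_(m1, m2) :=
  A - A *m A^T *m A.
Definition Nop (kappa : R) (m1 m2 : nat) (A : 'M[R]_(m1, m2)) :=
  kappa *: A + fnl A.

Definition heat_kernel (d : nat) (eps t : R) (z : 'rV[R]_d) : R :=
  ((Num.sqrt (4 * pi * eps ^+ 2 * t))^-1) ^+ d
  * expR (- sqnorm z / (4 * eps ^+ 2 * t)).

(* Periodic heat semigroup e^{t eps^2 Delta} applied (entrywise) to an
   Omega-periodic function W : R^d -> R^{m1 x m2} (periodic extension):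
   convolution with the Gaussian kernel for t > 0, identity for t = 0. *)
Definition heat_sg (d m1 m2 : nat) (eps t : R)
  (W : 'rV[R]_d -> 'M[R]_(m1, m2)) : 'rV[R]_d -> 'M[R]_(m1, m2) :=
  fun x => if t <= 0 then W x else
    \matrix_(i, j) iint (fun y => heat_kernel eps t (x - y) * W y i j).

Definition semigroupL (d m1 m2 : nat) (eps kappa t : R)
  (W : 'rV[R]_d -> 'M[R]_(m1, m2)) : 'rV[R]_d -> 'M[R]_(m1, m2) :=
  fun x => expR (- kappa * t) *: heat_sg eps t W x.

Definition box_closure (d : nat) (a L : 'rV[R]_d) : set 'rV[R]_d :=
  [set x | forall k, a 0 k <= x 0 k <= a 0 k + L 0 k].

Definition periodic (d m1 m2 : nat) (L : 'rV[R]_d)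
  (W : 'rV[R]_d -> 'M[R]_(m1, m2)) : Prop :=
  forall x k, W (x + L 0 k *: delta_mx 0 k) = W x.

Definition inX (d m1 m2 : nat) (L : 'rV[R]_d)
  (W : 'rV[R]_d -> 'M[R]_(m1, m2)) : Prop :=
  (forall x (e : R), 0 < e -> exists2 del : R, 0 < del &
     forall y, Num.sqrt (sqnorm (y - x)) < del -> frob (W y - W x) < e)
  /\ periodic L W.

Definition inXm (d m1 m2 : nat) (a L : 'rV[R]_d)
  (W : 'rV[R]_d -> 'M[R]_(m1, m2)) : Prop :=
  inX L W /\ forall x, box_closure a L x -> frob (W x) <= Num.sqrt (m2%:R).

Definition in_CXm (d m1 m2 : nat) (a L : 'rV[R]_d) (T : R)
  (U : R -> 'rV[R]_d -> 'M[R]_(m1, m2)) : Prop :=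
  (forall t, 0 <= t <= T -> inXm a L (U t)) /\
  (forall t, 0 <= t <= T -> forall e : R, 0 < e -> exists2 del : R, 0 < del &
     forall s, 0 <= s <= T -> `|s - t| < del ->
       forall x, box_closure a L x -> frob (U s x - U t x) < e).

(* Mild formulation: U(t) = e^{tL}U0 + int_0^t e^{(t-s)L} N[U(s)] ds,
   the X-valued integral being evaluated pointwise (entrywise). *)
Definition mild_solution (d m1 m2 : nat) (eps kappa T : R)
  (U0 : 'rV[R]_d -> 'M[R]_(m1, m2))
  (U : R -> 'rV[R]_d -> 'M[R]_(m1, m2)) : Prop :=
  forall t, 0 <= t <= T -> forall x,
    U t x = semigroupL eps kappa t U0 x
      + \matrix_(i, j) Rintegral (@lebesgue_measure R) `[0, t]
          (fun s => semigroupL eps kappa (t - s)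
                      (fun y => Nop kappa (U s y)) x i j).

End Defs.

(* Main.v *)
(* The map N is Lipschitz on the Frobenius ball of radius sqrt m2 and sends it into the
   ball of radius kappa sqrt m2; since e^{-kappa t} + int_0^t e^{-kappa (t-s)} kappa ds = 1,
   the Duhamel map preserves the bound sqrt m2, and it contracts by 1/2 in the norm
   sup_t e^{-lambda t} ||U(t)|| when lambda is twice the Lipschitz constant.  The mild
   solution is the limit of the Picard iterates.  After the substitution
   y = x + sigma z with sigma = eps sqrt (2 t), the heat semigroup becomes the Gaussian
   expectation E[W(x + sigma z)], which makes sense at t = 0 too; joint continuity in (t, x)
   then follows from uniform continuity of W and the first moment of the Gaussian, and
   the semigroup law is never needed. *)
Require Import Defs.
From HB Require Import structures.
From mathcomp Require Import all_boot all_order all_algebra.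
From mathcomp Require Import all_classical all_reals all_analysis.
From mathcomp Require Import measurable_realfun ring lra.
Import Order.TTheory GRing.Theory Num.Theory.
Import numFieldNormedType.Exports.
Local Open Scope ring_scope.
Local Open Scope classical_set_scope.
Set Implicit Arguments. Unset Strict Implicit. Unset Printing Implicit Defensive.

(** * The Frobenius norm and the nonlinearity *)

(** The Duhamel map is a time integral of iterated space integrals, both built from the total
    operator [Rintegral], so linearity and monotonicity are available only with integrability in
    hand. One condition carries the proof: a bound e + K * distance for every e > 0. It passes to
    slices, to Gaussian averages and to time integrals, it yields continuity and at most linear
    growth, and for bounded maps it amounts to uniform continuity. It also absorbs the width sqrt t
    of the heat kernel, which is not Lipschitz at t = 0. The exponential weight lets a single
    contraction cover all of [0, T], because the integral of lip e^{2 lip s} over [0, t] is at most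
    e^{2 lip t} / 2 whatever T is; no continuation in time takes place. Matrix integrals are taken
    entrywise and their Frobenius norms are reduced to scalar integrals by pairing with a fixed
    matrix. *)

Section Frobenius.
Variable R : realType.
Implicit Types m n p : nat.

Definition mxdot m n (A B : 'M[R]_(m, n)) : R := \tr (A^T *m B).

Lemma mxdotE m n (A B : 'M[R]_(m, n)) : mxdot A B = \sum_i \sum_j A i j * B i j.
Proof.
rewrite /mxdot /mxtrace exchange_big; apply: eq_bigr => i _.
by rewrite mxE; apply: eq_bigr => j _; rewrite mxE.
Qed.

Lemma mxdotC m n (A B : 'M[R]_(m, n)) : mxdot A B = mxdot B A.
Proof. by rewrite /mxdot -mxtrace_tr trmx_mul trmxK. Qed.

Lemma mxdotDr m n (A B C : 'M[R]_(m, n)) : mxdot A (B + C) = mxdot A B + mxdot A C.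
Proof. by rewrite /mxdot mulmxDr mxtraceD. Qed.

Lemma mxdotZr m n a (A B : 'M[R]_(m, n)) : mxdot A (a *: B) = a * mxdot A B.
Proof. by rewrite /mxdot -scalemxAr mxtraceZ. Qed.

Lemma mxdotDl m n (A B C : 'M[R]_(m, n)) : mxdot (B + C) A = mxdot B A + mxdot C A.
Proof. by rewrite -!(mxdotC A) mxdotDr. Qed.

Lemma mxdotZl m n a (A B : 'M[R]_(m, n)) : mxdot (a *: B) A = a * mxdot B A.
Proof. by rewrite -!(mxdotC A) mxdotZr. Qed.

Lemma mxdot_ge0 m n (A : 'M[R]_(m, n)) : 0 <= mxdot A A.
Proof.
by rewrite mxdotE; apply: sumr_ge0 => i _; apply: sumr_ge0 => j _; rewrite -expr2 sqr_ge0.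
Qed.

Lemma frobE m n (A : 'M[R]_(m, n)) : frob A = Num.sqrt (mxdot A A).
Proof. by rewrite mxdotE. Qed.

Lemma frob_ge0 m n (A : 'M[R]_(m, n)) : 0 <= frob A.
Proof. exact: sqrtr_ge0. Qed.

Lemma sqr_frob m n (A : 'M[R]_(m, n)) : frob A ^+ 2 = mxdot A A.
Proof. by rewrite frobE sqr_sqrtr ?mxdot_ge0. Qed.

Lemma frob0 m n : frob (0 : 'M[R]_(m, n)) = 0.
Proof. by rewrite frobE /mxdot mulmx0 mxtrace0 sqrtr0. Qed.

Lemma entry_le_frob m n (A : 'M[R]_(m, n)) i j : `|A i j| <= frob A.
Proof.
rewrite -sqrtr_sqr ler_wsqrtr// (bigD1 i)//= (bigD1 j)//= -addrA lerDl addr_ge0//.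
  by apply: sumr_ge0 => k _; exact: sqr_ge0.
by apply: sumr_ge0 => k _; apply: sumr_ge0 => l _; exact: sqr_ge0.
Qed.

Lemma entryB m n (A B : 'M[R]_(m, n)) i j : (A - B) i j = A i j - B i j.
Proof. by rewrite !mxE. Qed.

Lemma frob_eq0 m n (A : 'M[R]_(m, n)) : frob A = 0 -> A = 0.
Proof.
move=> A0; apply/matrixP => i j; rewrite mxE; apply/eqP; rewrite -normr_le0 -A0.
exact: entry_le_frob.
Qed.

Lemma mxdot_le m n (A B : 'M[R]_(m, n)) : mxdot A B <= frob A * frob B.
Proof.
have := mxdot_ge0 (frob B *: A + (- frob A) *: B).
rewrite mxdotDl !mxdotDr !mxdotZl !mxdotZr -!sqr_frob (mxdotC B A).
have [/frob_eq0 ->|A0] := eqVneq (frob A) 0.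
  by rewrite frob0 mul0r /mxdot trmx0 mul0mx mxtrace0.
have [/frob_eq0 ->|B0] := eqVneq (frob B) 0.
  by rewrite frob0 mulr0 /mxdot mulmx0 mxtrace0.
have A1 : 0 < frob A by rewrite lt0r A0 frob_ge0.
have B1 : 0 < frob B by rewrite lt0r B0 frob_ge0.
move=> H; rewrite -(ler_pM2l (mulr_gt0 A1 B1)).
move: H; rewrite -subr_ge0 => H; lra.
Qed.

Lemma frobZ m n a (A : 'M[R]_(m, n)) : frob (a *: A) = `|a| * frob A.
Proof.
by rewrite !frobE mxdotZl mxdotZr mulrA -expr2 sqrtrM ?sqr_ge0// sqrtr_sqr.
Qed.

Lemma frobN m n (A : 'M[R]_(m, n)) : frob (- A) = frob A.
Proof. by rewrite -scaleN1r frobZ normrN1 mul1r. Qed.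

Lemma frobD m n (A B : 'M[R]_(m, n)) : frob (A + B) <= frob A + frob B.
Proof.
rewrite -(@ler_pXn2r _ 2)// ?nnegrE ?addr_ge0 ?frob_ge0//.
rewrite sqr_frob mxdotDl !mxdotDr -!sqr_frob (mxdotC B A).
have := mxdot_le A B; lra.
Qed.

Lemma frobB m n (A B : 'M[R]_(m, n)) : frob (A - B) <= frob A + frob B.
Proof. by rewrite -(frobN B) frobD. Qed.

Lemma frobBC m n (A B : 'M[R]_(m, n)) : frob (A - B) = frob (B - A).
Proof. by rewrite -frobN opprB. Qed.

Lemma frob_le_add m n (A B : 'M[R]_(m, n)) : frob A <= frob B + frob (A - B).
Proof. by have := frobD B (A - B); rewrite addrC subrK. Qed.

Lemma frob_tri m n (B A C : 'M[R]_(m, n)) : frob (A - C) <= frob (A - B) + frob (B - C).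
Proof. by have := frobD (A - B) (B - C); rewrite addrA subrK. Qed.

Lemma frob_tr m n (A : 'M[R]_(m, n)) : frob A^T = frob A.
Proof. by rewrite !frobE /mxdot trmxK mxtrace_mulC. Qed.

(** Turns entrywise limits into Frobenius estimates. The natural factor sqrt (m n) is relaxed to m
    n, which is legitimate because a nonzero A forces m n >= 1. *)
Lemma frob_le_sum m n (A : 'M[R]_(m, n)) (e : R) :
  0 <= e -> (forall i j, `|A i j| <= e) -> frob A <= (m * n)%:R * e.
Proof.
move=> e0 Ae.
have [->|A0] := eqVneq A 0; first by rewrite frob0 mulr_ge0.
have mn0 : 1 <= (m * n)%:R :> R.
  rewrite ler1n lt0n; apply/eqP => mn0; move/eqP: A0; apply; apply/matrixP => i j.
  move/eqP: mn0; rewrite muln_eq0 => /orP[]/eqP mn0.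
    by move: (ltn_ord i); rewrite {2}mn0.
  by move: (ltn_ord j); rewrite {2}mn0.
rewrite -(@ler_pXn2r _ 2)// ?nnegrE ?mulr_ge0 ?frob_ge0//.
rewrite sqr_frob mxdotE exprMn.
apply: (@le_trans _ _ ((m * n)%:R * e ^+ 2)); last first.
  by rewrite ler_wpM2r ?sqr_ge0// expr2 ler_peMr// (le_trans ler01).
rewrite natrM -mulrA.
rewrite (_ : _ * _ = \sum_(i < m) \sum_(j < n) e ^+ 2); last first.
  by rewrite !sumr_const !card_ord !mulr_natl.
apply: ler_sum => i _.
apply: ler_sum => j _; rewrite -expr2 -real_normK ?num_real//.
by rewrite ler_pXn2r ?nnegrE.
Qed.

(** Each entry of the product pairs a row of A with a column of B. Cauchy-Schwarz bounds its square
    by a product of squared norms, and the double sum of these factors. *)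
Lemma frobM m n p (A : 'M[R]_(m, n)) (B : 'M[R]_(n, p)) :
  frob (A *m B) <= frob A * frob B.
Proof.
rewrite -(@ler_pXn2r _ 2)// ?nnegrE ?mulr_ge0 ?frob_ge0//.
rewrite exprMn (sqr_frob (A *m B)) mxdotE.
have rowE : frob A ^+ 2 = \sum_i frob (row i A) ^+ 2.
  rewrite sqr_frob mxdotE; apply: eq_bigr => i _.
  by rewrite sqr_frob mxdotE big_ord1; apply: eq_bigr => j _; rewrite !mxE.
have colE : frob B ^+ 2 = \sum_j frob (col j B) ^+ 2.
  rewrite sqr_frob mxdotE exchange_big; apply: eq_bigr => j _.
  rewrite sqr_frob mxdotE; apply: eq_bigr => i _.
  by rewrite big_ord1 !mxE.
rewrite rowE mulr_suml; apply: ler_sum => i _.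
rewrite colE mulr_sumr; apply: ler_sum => j _.
rewrite -exprMn -expr2 -[leLHS]real_normK ?num_real//.
rewrite ler_pXn2r ?nnegrE ?mulr_ge0 ?frob_ge0//.
have -> : (A *m B) i j = mxdot (row i A)^T (col j B).
  rewrite /mxdot trmxK /mxtrace big_ord1 !mxE; apply: eq_bigr => k _.
  by rewrite !mxE.
rewrite ler_norml -(frob_tr (row i A)) mxdot_le andbT lerNl.
rewrite -[- _]mulN1r -mxdotZl -(frobN (_^T)) scaleN1r; exact: mxdot_le.
Qed.

(** Separates the variation of the damping factor from that of the Gaussian average when two values
    of the semigroup are compared. *)
Lemma frob_comb m n (a b M : R) (A B : 'M[R]_(m, n)) :
  frob A <= M -> `|b| <= 1 -> frob (a *: A - b *: B) <= `|a - b| * M + frob (A - B).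
Proof.
move=> AM b1.
have -> : a *: A - b *: B = (a - b) *: A + b *: (A - B).
  by rewrite scalerBr scalerBl addrA subrK.
apply: le_trans (frobD _ _) _; rewrite !frobZ lerD ?ler_wpM2l//.
by rewrite ler_piMl ?frob_ge0.
Qed.

End Frobenius.

Section Nonlinearity.
Variable R : realType.

(* With s an eigenvalue of A^T A, s (kappa + 1 - s)^2 lies below its tangent at s = 1
   because the difference is (s - 1)^2 (s - 2 kappa); summing over eigenvalues is
   replaced by traces. *)
Lemma frob_Nop m1 m2 (kappa : R) (A : 'M[R]_(m1, m2)) :
  2 <= kappa -> m2%:R <= kappa -> frob A <= Num.sqrt m2%:R ->
  frob (Nop kappa A) <= kappa * Num.sqrt m2%:R.
Proof.
move=> k2 km Am.
have sA : frob A ^+ 2 <= m2%:R.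
  rewrite -[leRHS]sqr_sqrtr ?ler0n//.
  by rewrite ler_pXn2r ?nnegrE ?frob_ge0 ?sqrtr_ge0.
have k0 : 0 <= kappa by lra.
rewrite -(@ler_pXn2r _ 2)// ?nnegrE ?mulr_ge0 ?frob_ge0 ?sqrtr_ge0//.
rewrite exprMn (sqr_sqrtr (ler0n _ _)) sqr_frob.
have [S SE] : exists S, A^T *m A = S by exists (A^T *m A).
set a1 := \tr S; set a2 := \tr (S *m S); set a3 := \tr (S *m S *m S).
have AA : mxdot A A = a1 by rewrite /mxdot SE.
have a1E : a1 = frob A ^+ 2 by rewrite sqr_frob.
have ST : S^T = S by rewrite -SE trmx_mul trmxK.
have AS : mxdot A (A *m S) = a2 by rewrite /mxdot mulmxA SE.
have SS : mxdot (A *m S) (A *m S) = a3.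
  by rewrite /mxdot trmx_mul ST !mulmxA -(mulmxA S A^T A) SE.
have NE : mxdot (Nop kappa A) (Nop kappa A)
    = (kappa + 1) ^+ 2 * a1 - 2 * (kappa + 1) * a2 + a3.
  have -> : Nop kappa A = (kappa + 1) *: A + (-1) *: (A *m S).
    by rewrite /Nop /fnl -SE scalerDl scale1r addrA mulmxA scaleN1r.
  rewrite mxdotDl !mxdotDr !mxdotZl !mxdotZr (mxdotC (A *m S) A) AA AS SS.
  ring.
have DE : frob (S - 1%:M) ^+ 2 = a2 - 2 * a1 + m2%:R.
  rewrite sqr_frob -scaleN1r mxdotDl !mxdotDr !mxdotZl !mxdotZr (mxdotC 1%:M S).
  rewrite /mxdot ST trmx1 !mulmx1 mxtrace1 -/a1 -/a2; ring.
have PE : frob (A *m (S - 1%:M)) ^+ 2 = a3 - 2 * a2 + a1.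
  rewrite sqr_frob mulmxBr mulmx1 -scaleN1r mxdotDl !mxdotDr !mxdotZl !mxdotZr.
  rewrite (mxdotC (A *m S) A) AA AS SS; ring.
(* In eigenvalues the two sides are the sums of s (s - 1)^2 and of m2 (s - 1)^2; submultiplicativity
   stands in for s <= tr S <= m2. *)
have P2 : frob (A *m (S - 1%:M)) ^+ 2 <= m2%:R * frob (S - 1%:M) ^+ 2.
  apply: (@le_trans _ _ (frob A ^+ 2 * frob (S - 1%:M) ^+ 2)).
    by rewrite -exprMn ler_pXn2r ?nnegrE ?mulr_ge0 ?frob_ge0// frobM.
  by rewrite ler_wpM2r// sqr_ge0.
have P3 : m2%:R * frob (S - 1%:M) ^+ 2 <= 2 * kappa * frob (S - 1%:M) ^+ 2.
  by rewrite ler_wpM2r ?sqr_ge0//; lra.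
rewrite NE; move: P2 P3; rewrite PE DE => P2 P3.
(* The tangent at s = 1 has slope kappa (kappa - 2), nonnegative since kappa >= 2, so its sum over
   eigenvalues is largest when tr S reaches m2, where it equals m2 kappa^2. *)
have : a1 * (kappa * (kappa - 2)) <= m2%:R * (kappa * (kappa - 2)).
  by rewrite ler_wpM2r ?a1E// mulr_ge0//; lra.
move: P2 P3; move: (m2%:R : R) => M P2 P3 P4; lra.
Qed.

(** The cubic difference is telescoped one factor at a time. Each of the three terms contains A - B
    once and two factors from the ball, which contribute M. *)
Lemma Nop_lipschitz m1 m2 (kappa M : R) (A B : 'M[R]_(m1, m2)) :
  0 <= kappa -> 0 <= M -> frob A <= Num.sqrt M -> frob B <= Num.sqrt M ->
  frob (Nop kappa A - Nop kappa B) <= (kappa + 1 + 3 * M) * frob (A - B).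
Proof.
move=> k0 M0 AM BM.
have -> : Nop kappa A - Nop kappa B = (kappa + 1) *: (A - B)
   - ((A - B) *m A^T *m A + B *m (A - B)^T *m A + B *m B^T *m (A - B)).
  have -> : (A - B)^T = A^T - B^T by apply/matrixP => i j; rewrite !mxE.
  rewrite /Nop /fnl !(mulmxBl, mulmxBr) scalerDl scale1r scalerBr.
  apply/matrixP => i j; rewrite !mxE; ring.
apply: le_trans (frobB _ _) _; rewrite frobZ ger0_norm ?addr_ge0//.
rewrite [leRHS]mulrDl lerD2l.
have prodM (a b : R) : 0 <= a -> 0 <= b -> a <= Num.sqrt M -> b <= Num.sqrt M ->
    a * b <= M.
  move=> a0 b0 aM bM; rewrite -[leRHS]sqr_sqrtr// expr2; exact: ler_pM.
apply: le_trans (frobD _ _) _.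
have t1 : frob ((A - B) *m A^T *m A) <= M * frob (A - B).
  rewrite -mulmxA; apply: le_trans (frobM _ _) _.
  rewrite mulrC ler_wpM2r ?frob_ge0//; apply: le_trans (frobM _ _) _.
  by rewrite frob_tr prodM ?frob_ge0.
have t2 : frob (B *m (A - B)^T *m A) <= M * frob (A - B).
  apply: le_trans (frobM _ _) _.
  apply: (@le_trans _ _ (frob B * frob (A - B) * frob A)).
    by rewrite ler_wpM2r ?frob_ge0// -(frob_tr (A - B)) frobM.
  rewrite mulrAC ler_wpM2r ?frob_ge0//; exact: prodM (frob_ge0 _) (frob_ge0 _) _ _.
have t3 : frob (B *m B^T *m (A - B)) <= M * frob (A - B).
  apply: le_trans (frobM _ _) _.
  rewrite ler_wpM2r ?frob_ge0//; apply: le_trans (frobM _ _) _.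
  by rewrite frob_tr prodM ?frob_ge0.
have := frobD ((A - B) *m A^T *m A) (B *m (A - B)^T *m A); lra.
Qed.

End Nonlinearity.

(** * Iterated integrals *)

Section IteratedIntegral.
Variable R : realType.
Local Notation mu := (@lebesgue_measure R).

Definition slice n (F : 'rV[R]_n.+1 -> R) (y : R) : 'rV[R]_n -> R :=
  fun z => F (row_mx (y%:M : 'M[R]_(1, 1)) z : 'rV[R]_n.+1).

(** Integrability is asked at every level and for every slice, not for almost every one, so that the
    rules for [iint] follow from pointwise equalities of inner integrals without a product
    measure. *)
Fixpoint iintegrable n : ('rV[R]_n -> R) -> Prop :=
  match n return ('rV[R]_n -> R) -> Prop with
  | 0 => fun _ => True
  | n'.+1 => fun F => (forall y, iintegrable (slice F y)) /\
      mu.-integrable setT (EFin \o (fun y : R => iint (slice F y)))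
  end.

Lemma iintS n (F : 'rV[R]_n.+1 -> R) :
  iint F = Rintegral mu setT (fun y : R => iint (slice F y)).
Proof. by []. Qed.

Lemma integrable_setT_le (f : R -> R) (g : R -> R) :
  measurable_fun setT f -> mu.-integrable setT (EFin \o g) ->
  (forall x, `|f x| <= g x) -> mu.-integrable setT (EFin \o f).
Proof.
move=> mf ig fg; apply: le_integrable ig => //; first exact/measurable_EFinP.
by move=> x _ /=; rewrite lee_fin (le_trans (fg x))// ler_norm.
Qed.

Lemma iintZ n a (F : 'rV[R]_n -> R) : iintegrable F ->
  iintegrable (fun z => a * F z) /\ iint (fun z => a * F z) = a * iint F.
Proof.
elim: n F => [//|n IH] F [sF iF].
have E : (fun y => iint (slice (fun z => a * F z) y)) = (fun y => a * iint (slice F y)).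
  by apply/funext => y; exact: (IH _ (sF y)).2.
split; first split.
- by move=> y; exact: (IH _ (sF y)).1.
- rewrite E; exact: (integrableZl measurableT a iF).
- by rewrite !iintS E RintegralZl.
Qed.

Lemma iintD n (F G : 'rV[R]_n -> R) : iintegrable F -> iintegrable G ->
  iintegrable (fun z => F z + G z) /\ iint (fun z => F z + G z) = iint F + iint G.
Proof.
elim: n F G => [//|n IH] F G [sF iF] [sG iG].
have E : (fun y => iint (slice (fun z => F z + G z) y)) =
    (fun y => iint (slice F y) + iint (slice G y)).
  by apply/funext => y; exact: (IH _ _ (sF y) (sG y)).2.
split; first split.
- by move=> y; exact: (IH _ _ (sF y) (sG y)).1.
- rewrite E; exact: (integrableD measurableT iF iG).
- by rewrite !iintS E RintegralD.
Qed.

Lemma le_iint n (F G : 'rV[R]_n -> R) : iintegrable F -> iintegrable G ->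
  (forall z, F z <= G z) -> iint F <= iint G.
Proof.
elim: n F G => [|n IH] F G; first by move=> _ _ /(_ 0).
move=> [sF iF] [sG iG] FG; rewrite !iintS; apply: le_Rintegral => // y _.
by apply: (IH _ _ (sF y) (sG y)) => z; exact: FG.
Qed.

Let affine (x c : R) : R -> R := fun z => x + c * z.

Let measurable_affine x c : measurable_fun setT (affine x c).
Proof. by apply: measurable_funD => //; exact: measurable_funM. Qed.

(** Lebesgue measure is c times its push-forward under z -> x + c z: the two agree on half-open
    intervals, hence on all measurable sets. *)
Lemma ge0_integral_affine x c (f : R -> \bar R) : 0 < c ->
  measurable_fun setT f -> (forall y, 0 <= f y)%E ->
  (\int[mu]_y f y = c%:E * \int[mu]_z f (x + c * z)%R)%E.
Proof.
move=> c0 mf f0.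
have maff : @measurable_fun _ _ (measurableTypeR R) (measurableTypeR R) setT
  (affine x c) := measurable_affine x c.
pose phi : measurableTypeR R -> measurableTypeR R := affine x c.
pose nu0 : {measure set (measurableTypeR R) -> \bar R} :=
  mscale (NngNum (ltW c0)) (pushforward mu phi).
pose nu := nu0 maff.
have munu (A : set (measurableTypeR R)) : measurable A -> mu A = nu A.
  move=> mA; apply: (@lebesgue_measure_unique R nu) mA => _ [[a b]] _ <-.
  rewrite /nu /nu0 /= /mscale /= /pushforward.
  rewrite (_ : _ @^-1` _ = `](a - x) / c, (b - x) / c]%classic); last first.
    apply/seteqP; split => z /=; rewrite /affine !in_itv/= => /andP[az zb].
      apply/andP; split; first by rewrite ltr_pdivrMr// mulrC ltrBlDl.
      by rewrite ler_pdivlMr// mulrC lerBrDl.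
    apply/andP; split; first by rewrite -ltrBlDl mulrC -ltr_pdivrMr.
    by rewrite -lerBrDl mulrC -ler_pdivlMr.
  rewrite !lebesgue_measure_itv/= !lte_fin ltr_pM2r ?invr_gt0// ltrD2r.
  case: ifPn => ab; last by rewrite mule0.
  rewrite -!EFinB -EFinM; congr EFin; field; exact: lt0r_neq0.
transitivity (\int[nu]_y f y)%E.
  by apply: eq_measure_integral => A mA _; exact: munu.
rewrite ge0_integral_mscale//=; congr (_ * _)%E.
by rewrite ge0_integral_pushforward.
Qed.

Lemma Rintegral_affine x c (f : R -> R) : 0 < c ->
  mu.-integrable setT (EFin \o (fun z => f (x + c * z))) ->
  Rintegral mu setT f = c * Rintegral mu setT (fun z => f (x + c * z)).
Proof.
move=> c0 ig.
(* Only the substituted function is assumed integrable; measurability of [f] itself is recovered by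
   undoing the affine map. *)
have mf : measurable_fun setT f.
  have -> : f = (fun z => f (x + c * z)) \o affine (- x / c) c^-1.
    apply/funext => y /=; rewrite /affine; congr f; field; exact: lt0r_neq0.
  apply: measurableT_comp; last exact: measurable_affine.
  by apply/measurable_EFinP; exact: measurable_int ig.
have mEf : measurable_fun setT (EFin \o f) by exact/measurable_EFinP.
have ip := integrable_pos_fin_num measurableT ig.
have im := integrable_neg_fin_num measurableT ig.
pose h z := x + c * z; pose fh z := f (h z).
have Ep : (EFin \o fh)^\+%E = (EFin \o f)^\+%E \o h.
  by rewrite -funepos_comp.
have En : (EFin \o fh)^\-%E = (EFin \o f)^\-%E \o h.
  by rewrite -funeneg_comp.
rewrite /Rintegral [in LHS]integralE.
rewrite (@ge0_integral_affine x c (EFin \o f)^\+%E)//; last exact: measurable_funepos.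
rewrite (@ge0_integral_affine x c (EFin \o f)^\-%E)//; last exact: measurable_funeneg.
rewrite -muleBr//; last first.
  by apply: fin_num_adde_defr; move: ip; rewrite Ep.
rewrite -[RHS]/(fine c%:E * _) -fineM//; last exact: integrable_fin_num.
by rewrite [in RHS]integralE -/fh Ep En.
Qed.

Lemma affine_row_mx n (x : 'rV[R]_n.+1) (c y : R) (z : 'rV[R]_n) :
  x + c *: (row_mx (y%:M : 'M[R]_(1, 1)) z : 'rV[R]_n.+1)
  = row_mx ((x 0 0 + c * y)%:M : 'M[R]_(1, 1)) (rsubmx (x : 'rV[R]_(1 + n)) + c *: z).
Proof.
transitivity (row_mx (lsubmx (x : 'rV[R]_(1 + n))) (rsubmx (x : 'rV[R]_(1 + n)))
    + c *: row_mx (y%:M : 'M[R]_(1, 1)) z); first by rewrite hsubmxK.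
rewrite scale_row_mx add_row_mx; congr (row_mx _ _ : 'rV[R]_(1 + n)).
apply/matrixP => i j; rewrite !ord1 !mxE/= !mulr1n; congr (x _ _ + _).
exact/val_inj.
Qed.

(** The integrability hypothesis is placed after the substitution, because there the integrand
    becomes a standard Gaussian times a function of controlled growth. *)
Lemma iint_affine n (x : 'rV[R]_n) (c : R) (F : 'rV[R]_n -> R) : 0 < c ->
  iintegrable (fun z => F (x + c *: z)) ->
  iint F = c ^+ n * iint (fun z => F (x + c *: z)).
Proof.
move=> c0; elim: n x F => [|n IH] x F.
  by move=> _; rewrite expr0 mul1r /=; congr F; apply/rowP => -[].
set x' := rsubmx (x : 'rV[R]_(1 + n)).
have sE y : slice (fun z => F (x + c *: z)) y =
    (fun z => slice F (x 0 0 + c * y) (x' + c *: z)).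
  by apply/funext => z; rewrite /slice affine_row_mx.
move=> [sF iF].
have sF' y : iintegrable (fun z => slice F (x 0 0 + c * y) (x' + c *: z)).
  by rewrite -sE; exact: sF.
have E1 y : iint (slice F (x 0 0 + c * y)) =
    c ^+ n * iint (slice (fun z => F (x + c *: z)) y).
  by rewrite sE -(IH x').
have iF' : mu.-integrable setT
    (EFin \o (fun y => iint (slice F (x 0 0 + c * y)))).
  by under [X in EFin \o X]eq_fun do rewrite E1; exact: (integrableZl measurableT (c ^+ n) iF).
rewrite !iintS (Rintegral_affine c0 iF') exprSr (mulrC _ c) -mulrA; congr (_ * _).
rewrite -RintegralZl//; exact: eq_Rintegral.
Qed.

End IteratedIntegral.

(** * Gaussian expectations *)

Section GaussianExpectation.
Variable R : realType.
Local Notation mu := (@lebesgue_measure R).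

(** Preferred to the Euclidean norm because it splits as a plain sum when the first coordinate is
    peeled off, as the inductions on the dimension require. *)
Definition norm1 n (z : 'rV[R]_n) : R := \sum_i `|z 0 i|.

Lemma norm1_ge0 n (z : 'rV[R]_n) : 0 <= norm1 z.
Proof. exact: sumr_ge0. Qed.

Lemma norm1Z n c (z : 'rV[R]_n) : norm1 (c *: z) = `|c| * norm1 z.
Proof. by rewrite /norm1 mulr_sumr; apply: eq_bigr => i _; rewrite mxE normrM. Qed.

Lemma norm1D n (x y : 'rV[R]_n) : norm1 (x + y) <= norm1 x + norm1 y.
Proof. by rewrite /norm1 -big_split; apply: ler_sum => i _; rewrite mxE ler_normD. Qed.

Lemma norm10 n : norm1 (0 : 'rV[R]_n) = 0.
Proof. by rewrite /norm1 big1// => i _; rewrite mxE normr0. Qed.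

Lemma norm1N n (x : 'rV[R]_n) : norm1 (- x) = norm1 x.
Proof. by rewrite -scaleN1r norm1Z normrN1 mul1r. Qed.

Lemma sum_row_mx n (f : R -> R) (y : R) (z : 'rV[R]_n) :
  \sum_i f ((row_mx (y%:M : 'M[R]_(1, 1)) z : 'rV[R]_n.+1) 0 i) = f y + \sum_i f (z 0 i).
Proof.
rewrite big_ord_recl; congr (f _ + _).
  rewrite (_ : ord0 = lshift n (ord0 : 'I_1)); last exact: val_inj.
  by rewrite (@row_mxEl R 1 1 n) mxE eqxx mulr1n.
apply: eq_bigr => i _; rewrite (_ : lift ord0 i = rshift 1 i); last exact: val_inj.
by rewrite (@row_mxEr R 1 1 n).
Qed.

Lemma norm1_row_mx n (y : R) (z : 'rV[R]_n) :
  norm1 (row_mx (y%:M : 'M[R]_(1, 1)) z : 'rV[R]_n.+1) = `|y| + norm1 z.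
Proof. exact: (sum_row_mx Num.norm). Qed.

Lemma sqnorm_row_mx n (y : R) (z : 'rV[R]_n) :
  sqnorm (row_mx (y%:M : 'M[R]_(1, 1)) z : 'rV[R]_n.+1) = y ^+ 2 + sqnorm z.
Proof. exact: (sum_row_mx (fun t => t ^+ 2)). Qed.

(* Uniform continuity in affine form: unlike a modulus of continuity, the bound
   e + K t can be integrated against a Gaussian using its first moment only. *)
Definition ucont n (W : 'rV[R]_n -> R) := forall e : R, 0 < e ->
  exists2 K, 0 <= K & forall x y, `|W x - W y| <= e + K * norm1 (x - y).

Lemma ucont_cst n (a : R) : ucont (fun _ : 'rV[R]_n => a).
Proof.
by move=> e e0; exists 0 => // x y; rewrite subrr normr0 mul0r addr0 ltW.
Qed.

Lemma ucontD n (F G : 'rV[R]_n -> R) : ucont F -> ucont G -> ucont (fun z => F z + G z).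
Proof.
move=> uF uG e e0; have e2 : 0 < e / 2 by rewrite divr_gt0.
have [K K0 FK] := uF _ e2; have [K' K'0 GK] := uG _ e2.
exists (K + K'); first exact: addr_ge0.
move=> x y; rewrite opprD addrACA; apply: le_trans (ler_normD _ _) _.
by have := FK x y; have := GK x y; lra.
Qed.

Lemma ucontZ n a (F : 'rV[R]_n -> R) : ucont F -> ucont (fun z => a * F z).
Proof.
move=> uF e e0.
have a1 : 0 < `|a| + 1 by rewrite ltr_wpDl.
have [K K0 FK] := uF (e / (`|a| + 1)) (divr_gt0 e0 a1).
exists (`|a| * K); first exact: mulr_ge0.
move=> x y; rewrite -mulrBr normrM.
apply: le_trans (ler_wpM2l (normr_ge0 a) (FK x y)) _.
rewrite mulrDr (mulrA _ K) lerD2r mulrA ler_pdivrMr// mulrC.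
by rewrite ler_wpM2l ?ltW// ltrDl.
Qed.

Lemma ucont_norm1 n : ucont (@norm1 n).
Proof.
move=> e e0; exists 1 => // x y; rewrite mul1r; apply: ler_wpDl; first exact: ltW.
rewrite ler_norml; have := norm1D y (x - y); have := norm1D x (y - x).
rewrite !(addrC _ (_ - _)) !subrK -(opprB x y) norm1N; lra.
Qed.

Lemma ucont_affine n (W : 'rV[R]_n -> R) x c : ucont W -> ucont (fun z => W (x + c *: z)).
Proof.
move=> uW e e0; have [K K0 WK] := uW e e0.
exists (K * `|c|); first exact: mulr_ge0.
move=> y z; apply: le_trans (WK _ _) _.
by rewrite opprD addrACA subrr add0r -scalerBr norm1Z mulrA.
Qed.

Lemma ucont_slice n (W : 'rV[R]_n.+1 -> R) y : ucont W -> ucont (slice W y).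
Proof.
move=> uW e e0; have [K K0 WK] := uW e e0; exists K => // z z'.
apply: le_trans (WK _ _) _; rewrite lerD2l ler_wpM2l//.
rewrite (_ : _ - _ = row_mx ((0 : R)%:M : 'M[R]_(1, 1)) (z - z') :> 'rV[R]_(1 + n)).
  by rewrite norm1_row_mx normr0 add0r.
by rewrite opp_row_mx add_row_mx subrr raddf0.
Qed.

Definition gauss1 (y : R) : R := (Num.sqrt (2 * pi))^-1 * expR (- y ^+ 2 / 2).

Definition gauss n (z : 'rV[R]_n) : R :=
  (Num.sqrt (2 * pi))^-1 ^+ n * expR (- sqnorm z / 2).

Lemma gauss1_ge0 y : 0 <= gauss1 y.
Proof. by rewrite mulr_ge0 ?expR_ge0// invr_ge0 sqrtr_ge0. Qed.

Lemma gauss_ge0 n (z : 'rV[R]_n) : 0 <= gauss z.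
Proof. by rewrite mulr_ge0 ?expR_ge0// exprn_ge0// invr_ge0 sqrtr_ge0. Qed.

Lemma gauss_row_mx n (y : R) (z : 'rV[R]_n) :
  gauss (row_mx (y%:M : 'M[R]_(1, 1)) z : 'rV[R]_n.+1) = gauss1 y * gauss z.
Proof.
rewrite /gauss sqnorm_row_mx opprD (mulrDl (- y ^+ 2)) expRD exprS /gauss1; ring.
Qed.

Lemma gauss1E : gauss1 = normal_pdf 0 1.
Proof.
apply/funext => y; rewrite normal_pdfE ?oner_neq0// /gauss1 /normal_peak /normal_fun.
by rewrite expr1n mul1r mulr_natl subr0.
Qed.

(** Provides the first moment by domination: the density of standard deviation 2 decays like
    e^{-y^2/8}, which leaves a factor e^{-3y^2/8} to absorb 1 + |y|. *)
Lemma gauss1_tail (y : R) : gauss1 y * (1 + `|y|) <=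
  2 * (Num.sqrt (2 * pi))^-1 / normal_peak 2 * normal_pdf 0 2 y.
Proof.
have two0 : (2 : R) != 0 by rewrite pnatr_eq0.
rewrite normal_pdfE// /normal_fun subr0 /gauss1.
have : normal_peak 2 != 0 :> R by rewrite gt_eqF// normal_peak_gt0.
have : 0 <= (Num.sqrt (2 * pi))^-1 :> R by rewrite invr_ge0 sqrtr_ge0.
move: (normal_peak 2) (Num.sqrt _)^-1 => p P P0 p0.
rewrite [leRHS](_ : _ = P * (2 * expR (- y ^+ 2 / (2 ^+ 2 *+ 2)))); last first.
  by move: (expR _) => E; field.
rewrite -mulrA ler_wpM2l//.
have -> : - y ^+ 2 / 2 = - y ^+ 2 / (2 ^+ 2 *+ 2) - 3 * y ^+ 2 / 8.
  by rewrite -mulr_natr; field.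
rewrite expRD -mulrA (mulrC 2) ler_wpM2l ?expR_ge0// expRN.
rewrite mulrC ler_pdivrMr ?expR_gt0//.
(* It suffices that 1 + |y| <= 2 (1 + 3 y^2 / 8), and the difference of the two sides is (3 |y| -
   2)^2 / 12 + 2/3. *)
have := expR_ge1Dx (3 * y ^+ 2 / 8 : R).
have := sqr_ge0 (3 * `|y| - 2); have := real_normK (num_real y).
move: (expR _) `|y| => E z <- H; lra.
Qed.

(** The modulus is used twice: small e gives continuity, hence measurability, and e = 1 gives linear
    growth, which [gauss1_tail] dominates. *)
Lemma integrable_gauss1_mul (g : R -> R) :
  (forall e, 0 < e -> exists2 K, 0 <= K & forall x y, `|g x - g y| <= e + K * `|x - y|) ->
  mu.-integrable setT (EFin \o (fun y => gauss1 y * g y)).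
Proof.
move=> ug.
have cg : continuous g.
  move=> x; apply/cvgrPdist_le => e e0.
  have [K K0 gK] := ug (e / 2) (divr_gt0 e0 (ltr0n _ 2)).
  have K1 : 0 < K + 1 by rewrite ltr_wpDl.
  near=> y; apply: le_trans (gK _ _) _.
  rewrite [leRHS]splitr lerD2l.
  apply: (@le_trans _ _ ((K + 1) * `|x - y|)).
    by rewrite ler_wpM2r// lerDl.
  rewrite mulrC -ler_pdivlMr//; near: y; apply: cvgr_dist_le; first exact: cvg_id.
  by rewrite !divr_gt0.
have [K K0 gK] := ug 1 ltr01.
pose C := `|g 0| + 1 + K.
have C0 : 0 <= C by rewrite !addr_ge0.
have gC y : `|g y| <= C * (1 + `|y|).
  have := gK y 0; rewrite subr0 => gKy.
  have := ler_normD (g y - g 0) (g 0); rewrite subrK => gy.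
  have := mulr_ge0 (normr_ge0 (g 0)) (normr_ge0 y).
  have := normr_ge0 y; rewrite /C; lra.
pose D := C * (2 * (Num.sqrt (2 * pi))^-1 / normal_peak 2).
apply: (@integrable_setT_le _ _ (fun y => D * normal_pdf 0 2 y)).
- apply: continuous_measurable_fun => y; apply: cvgM; last exact: cg.
  by rewrite gauss1E; apply: continuous_normal_pdf; rewrite oner_neq0.
- exact: (integrableZl measurableT D (integrable_normal_pdf 0 2)).
- move=> y; rewrite normrM ger0_norm ?gauss1_ge0//.
  apply: (@le_trans _ _ (C * (gauss1 y * (1 + `|y|)))).
    by rewrite mulrCA ler_wpM2l ?gauss1_ge0.
  by rewrite /D -[leRHS]mulrA ler_wpM2l// gauss1_tail.
Unshelve. all: by end_near. Qed.

(** The two claims share one induction: averaging over the remaining coordinates keeps the same e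
    and K for the first one precisely because the lower-dimensional Gaussian has mass 1. *)
Lemma iintegrable_gauss_mul n :
  (forall W : 'rV[R]_n -> R, ucont W -> iintegrable (fun z => gauss z * W z)) /\
  iint (@gauss n) = 1.
Proof.
elim: n => [|n [IH1 IH2]].
  split=> //=; rewrite /gauss expr0 mul1r /sqnorm big_ord0 oppr0 mul0r.
  exact: expR0.
have ig : iintegrable (@gauss n).
  have -> : @gauss n = (fun z => gauss z * 1) by apply/funext => z; rewrite mulr1.
  exact/IH1/ucont_cst.
split; last first.
  rewrite iintS (_ : (fun y => _) = gauss1).
    by rewrite gauss1E /Rintegral integral_normal_pdf.
  apply/funext => y; rewrite (_ : slice _ _ = (fun z => gauss1 y * gauss z)).
    by rewrite (iintZ _ ig).2 IH2 mulr1.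
  by apply/funext => z; rewrite /slice gauss_row_mx.
move=> W uW.
have sE y : slice (fun z => gauss z * W z) y =
    (fun z => gauss1 y * (gauss z * slice W y z)).
  by apply/funext => z; rewrite /slice gauss_row_mx mulrA.
have is_ y := IH1 _ (ucont_slice y uW).
split; first by move=> y; rewrite sE; exact: (iintZ _ (is_ y)).1.
pose g y := iint (fun z => gauss z * slice W y z).
rewrite (_ : (fun y => _) = (fun y => gauss1 y * g y)); last first.
  by apply/funext => y; rewrite sE (iintZ _ (is_ y)).2.
apply: integrable_gauss1_mul => e e0.
have [K K0 WK] := uW e e0; exists K => //.
have gle x y : g x <= g y + (e + K * `|x - y|).
  have [i1 e1] := iintZ (e + K * `|x - y|) ig.
  have [i2 e2] := iintD (is_ y) i1.
  rewrite -[X in _ + X]mulr1 -IH2 -e1 -e2; apply: le_iint => // z.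
  rewrite (mulrC _ (gauss z)) -mulrDr ler_wpM2l ?gauss_ge0//.
  rewrite -lerBlDl; apply: le_trans (ler_norm _) _.
  apply: le_trans (WK _ _) _; rewrite lerD2l ler_wpM2l//.
  rewrite (_ : _ - _ = row_mx ((x - y)%:M : 'M[R]_(1, 1)) 0 :> 'rV[R]_(1 + n)).
    by rewrite norm1_row_mx norm10 addr0.
  by rewrite opp_row_mx add_row_mx subrr -raddfB.
move=> x y; rewrite ler_norml; have := gle x y; have := gle y x.
rewrite (distrC y x); lra.
Qed.

Definition gexp n (W : 'rV[R]_n -> R) : R := iint (fun z => gauss z * W z).

Lemma gexpD n (F G : 'rV[R]_n -> R) : ucont F -> ucont G ->
  gexp (fun z => F z + G z) = gexp F + gexp G.
Proof.
move=> uF uG; have [I _] := iintegrable_gauss_mul n.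
rewrite -(iintD (I _ uF) (I _ uG)).2; congr iint; apply/funext => z.
exact: mulrDr.
Qed.

Lemma gexpZ n a (F : 'rV[R]_n -> R) : ucont F -> gexp (fun z => a * F z) = a * gexp F.
Proof.
move=> uF; have [I _] := iintegrable_gauss_mul n.
rewrite -(iintZ a (I _ uF)).2; congr iint; apply/funext => z; exact: mulrCA.
Qed.

Lemma le_gexp n (F G : 'rV[R]_n -> R) : ucont F -> ucont G ->
  (forall z, F z <= G z) -> gexp F <= gexp G.
Proof.
move=> uF uG FG; have [I _] := iintegrable_gauss_mul n.
apply: le_iint => [||z]; [exact: I|exact: I|].
by rewrite ler_wpM2l ?gauss_ge0.
Qed.

Lemma gexp_cst n a : gexp (fun _ : 'rV[R]_n => a) = a.
Proof.
have [I I1] := iintegrable_gauss_mul n.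
have ig := I _ (@ucont_cst n 1).
rewrite -[RHS]mulr1 -I1 /gexp (_ : @gauss n = (fun z => gauss z * 1)).
  by rewrite -(iintZ a ig).2; congr iint; apply/funext => z; rewrite mulr1 mulrC.
by apply/funext => z; rewrite mulr1.
Qed.

Lemma gexp_norm1_ge0 n : 0 <= gexp (@norm1 n).
Proof.
rewrite -(gexp_cst n 0); apply: le_gexp; [exact: ucont_cst|exact: ucont_norm1|].
exact: norm1_ge0.
Qed.

End GaussianExpectation.

(** * The heat semigroup *)

Section MatrixFunctional.
Variables (R : realType) (S : Type) (D : S -> Prop) (C : (S -> R) -> Prop)
  (I : (S -> R) -> R).
Hypotheses (C0 : C (fun=> 0))
  (CD : forall F G, C F -> C G -> C (fun s => F s + G s))
  (ID : forall F G, C F -> C G -> I (fun s => F s + G s) = I F + I G)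
  (CZ : forall a F, C F -> C (fun s => a * F s))
  (IZ : forall a F, C F -> I (fun s => a * F s) = a * I F)
  (I_le : forall F G, C F -> C G -> (forall s, D s -> F s <= G s) -> I F <= I G).

Lemma functional0 : I (fun=> 0) = 0.
Proof.
rewrite -[RHS](mul0r (I (fun=> 0))) -IZ//; congr I.
by apply/funext => s; rewrite mul0r.
Qed.

Lemma functional_sum (T : Type) (r : seq T) (F : T -> S -> R) :
  (forall i, C (F i)) ->
  C (fun s => \sum_(i <- r) F i s) /\
  I (fun s => \sum_(i <- r) F i s) = \sum_(i <- r) I (F i).
Proof.
move=> CF; elim: r => [|i r [IH1 IH2]].
  under eq_fun do rewrite big_nil; rewrite big_nil; split; first exact: C0.
  exact: functional0.
under eq_fun do rewrite big_cons; rewrite big_cons -IH2.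
by split; [exact: CD|exact: ID].
Qed.

(* The Frobenius norm is a supremum of linear forms, which commute with I. *)
Lemma frob_functional m n (V : S -> 'M[R]_(m, n)) (b : S -> R) :
  (forall i j, C (fun s => V s i j)) -> C b -> (forall s, D s -> frob (V s) <= b s) ->
  frob (\matrix_(i, j) I (fun s => V s i j)) <= I b.
Proof.
move=> CV Cb Vb; set A := \matrix_(_, _) _.
have Ib0 : 0 <= I b.
  rewrite -functional0; apply: I_le => // s Ds; exact: le_trans (frob_ge0 _) (Vb s Ds).
have [->//|A0] := eqVneq (frob A) 0.
have A1 : 0 < frob A by rewrite lt0r A0 frob_ge0.
have Cij i j : C (fun s => A i j * V s i j) by exact: CZ.
have Ci i := functional_sum (index_enum 'I_n) (Cij i).
have Cs := functional_sum (index_enum 'I_m) (fun i => (Ci i).1).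
(* Pairing with the matrix A itself: frob A ^ 2 is I of the scalar function <A, V s>, which
   Cauchy-Schwarz bounds by frob A * b s; one factor frob A then cancels. *)
rewrite -(ler_pM2l A1) -IZ// -expr2 sqr_frob mxdotE.
have -> : \sum_i \sum_j A i j * A i j = I (fun s => \sum_i \sum_j A i j * V s i j).
  rewrite Cs.2; apply: eq_bigr => i _; rewrite (Ci i).2.
  by apply: eq_bigr => j _; rewrite IZ// mxE.
apply: I_le => [||s Ds]; [exact: Cs.1|exact: CZ|].
rewrite -mxdotE; apply: le_trans (mxdot_le _ _) _.
by rewrite ler_wpM2l ?frob_ge0// Vb.
Qed.

End MatrixFunctional.

Section HeatSemigroup.
Variable R : realType.
Variables d m n : nat.
Implicit Types W : 'rV[R]_d -> 'M[R]_(m, n).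

Definition mucont W := forall e : R, 0 < e ->
  exists2 K, 0 <= K & forall x y, frob (W x - W y) <= e + K * norm1 (x - y).

Lemma mucont_entry W i j : mucont W -> ucont (fun z => W z i j).
Proof.
move=> uW e e0; have [K K0 WK] := uW e e0; exists K => // x y.
apply: le_trans (WK x y).
by have := entry_le_frob (W x - W y) i j; rewrite !mxE.
Qed.

Lemma frob_gexp (V : 'rV[R]_d -> 'M[R]_(m, n)) (b : 'rV[R]_d -> R) :
  (forall i j, ucont (fun z => V z i j)) -> ucont b -> (forall z, frob (V z) <= b z) ->
  frob (\matrix_(i, j) gexp (fun z => V z i j)) <= gexp b.
Proof.
move=> uV ub Vb.
apply: (@frob_functional R _ (fun=> True) (@ucont R d) (@gexp R d)) => //.
- exact: ucont_cst.
- exact: ucontD.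
- exact: gexpD.
- by move=> a F; exact: ucontZ.
- by move=> a F; exact: gexpZ.
- by move=> F G uF uG FG; apply: le_gexp => // z; exact: FG.
Qed.

Definition hconv (sigma : R) W x : 'M[R]_(m, n) :=
  \matrix_(i, j) gexp (fun z => W (x + sigma *: z) i j).

Lemma ucont_hconv sigma W x i j : mucont W -> ucont (fun z => W (x + sigma *: z) i j).
Proof. by move=> uW; exact: (ucont_affine x sigma (mucont_entry i j uW)). Qed.

Lemma hconv_bound sigma W x M : mucont W -> (forall y, frob (W y) <= M) ->
  frob (hconv sigma W x) <= M.
Proof.
move=> uW WM; rewrite -[leRHS](@gexp_cst R d); apply: frob_gexp => //.
- by move=> i j; exact: ucont_hconv.
- exact: ucont_cst.
Qed.

(** A coupling argument: both averages are driven by the same Gaussian z, so their arguments differ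
    by (x - x') + (sigma - sigma') z, and only the first moment of z enters. *)
Lemma hconv_dist sigma sigma' W W' x x' D K : mucont W -> mucont W' -> 0 <= K ->
  (forall u u', frob (W u - W' u') <= D + K * norm1 (u - u')) ->
  frob (hconv sigma W x - hconv sigma' W' x') <=
    D + K * (norm1 (x - x') + `|sigma - sigma'| * gexp (@norm1 R d)).
Proof.
move=> uW uW' K0 WW.
have -> : hconv sigma W x - hconv sigma' W' x' =
    \matrix_(i, j) gexp (fun z => (W (x + sigma *: z) - W' (x' + sigma' *: z)) i j).
  apply/matrixP => i j; rewrite !mxE -mulN1r -gexpZ; last exact: ucont_hconv.
  rewrite -gexpD; [|exact: ucont_hconv|exact/ucontZ/ucont_hconv].
  by congr gexp; apply/funext => z; rewrite !mxE mulN1r.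
pose b (z : 'rV[R]_d) := (D + K * norm1 (x - x')) + K * `|sigma - sigma'| * norm1 z.
have -> : D + K * (norm1 (x - x') + `|sigma - sigma'| * gexp (@norm1 R d)) = gexp b.
  rewrite gexpD; [|exact: ucont_cst|exact/ucontZ/ucont_norm1].
  by rewrite gexp_cst gexpZ; [ring|exact: ucont_norm1].
apply: frob_gexp => [i j||z].
- rewrite (_ : (fun z => _) =
    (fun z => W (x + sigma *: z) i j + -1 * W' (x' + sigma' *: z) i j)).
    by apply: ucontD; [exact: ucont_hconv|exact/ucontZ/ucont_hconv].
  by apply/funext => z; rewrite !mxE mulN1r.
- by apply: ucontD; [exact: ucont_cst|exact/ucontZ/ucont_norm1].
- apply: le_trans (WW _ _) _; rewrite /b -[leRHS]addrA lerD2l -mulrA -mulrDr ler_wpM2l//.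
  rewrite opprD addrACA -scalerBl; apply: le_trans (norm1D _ _) _.
  by rewrite norm1Z.
Qed.

Lemma heat_sgE (eps t : R) W x : 0 < eps -> 0 <= t -> mucont W ->
  heat_sg eps t W x = hconv (eps * Num.sqrt (2 * t)) W x.
Proof.
move=> eps0 t0 uW; apply/matrixP => i j; rewrite /heat_sg mxE.
(* At t = 0 [heat_sg] returns [W x] by definition; the average agrees since its width vanishes and
   the Gaussian has mass 1. *)
case: (leP t 0) => [t_le0|t_gt0].
  have -> : t = 0 by apply/eqP; rewrite eq_le t_le0.
  rewrite mulr0 sqrtr0 mulr0; under [X in gexp X]eq_fun do rewrite scale0r addr0.
  by rewrite gexp_cst.
rewrite mxE; set sigma := eps * _.
have sigma0 : 0 < sigma by rewrite mulr_gt0// sqrtr_gt0 mulr_gt0.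
have sigma2 : sigma ^+ 2 = 2 * eps ^+ 2 * t.
  rewrite /sigma exprMn sqr_sqrtr; last by rewrite mulr_ge0.
  ring.
(* The normalisation of the kernel contributes sigma^{-d}, which the Jacobian sigma^d of the
   substitution cancels at the end. *)
have FE : (fun z => heat_kernel eps t (x - (x + sigma *: z)) * W (x + sigma *: z) i j)
    = (fun z => sigma^-1 ^+ d * (gauss z * W (x + sigma *: z) i j)).
  apply/funext => z; rewrite mulrA; congr (_ * _).
  rewrite /heat_kernel /gauss [RHS]mulrA -exprMn; congr (_ ^+ d * expR _).
    rewrite -invfM; congr (_^-1).
    rewrite -[sigma]ger0_norm ?ltW// -sqrtr_sqr -sqrtrM ?sqr_ge0// sigma2.
    by congr (Num.sqrt _); ring.
  have -> : sqnorm (x - (x + sigma *: z)) = sigma ^+ 2 * sqnorm z.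
    rewrite /sqnorm mulr_sumr; apply: eq_bigr => k _; rewrite !mxE; ring.
  rewrite sigma2; field; rewrite !gt_eqF//.
have [I _] := iintegrable_gauss_mul R d.
have ig := I _ (ucont_hconv sigma x i j uW).
have [iF EF] := iintZ (sigma^-1 ^+ d) ig.
rewrite (@iint_affine R d x sigma) ?FE// EF mulrA -exprMn divff ?lt0r_neq0//.
by rewrite expr1n mul1r.
Qed.

Lemma semigroupLE (eps kappa t : R) W x : 0 < eps -> 0 <= t -> mucont W ->
  semigroupL eps kappa t W x =
    expR (- kappa * t) *: hconv (eps * Num.sqrt (2 * t)) W x.
Proof. by move=> e0 t0 uW; rewrite /semigroupL heat_sgE. Qed.

Lemma frob_semigroupL (eps kappa t : R) W x M : 0 < eps -> 0 <= t -> mucont W ->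
  (forall y, frob (W y) <= M) ->
  frob (semigroupL eps kappa t W x) <= expR (- kappa * t) * M.
Proof.
move=> e0 t0 uW WM; rewrite semigroupLE// frobZ ger0_norm ?expR_ge0//.
by rewrite ler_wpM2l ?expR_ge0// hconv_bound.
Qed.

Lemma frob_semigroupLB (eps kappa t : R) W W' x M : 0 < eps -> 0 <= t ->
  mucont W -> mucont W' -> (forall y, frob (W y - W' y) <= M) ->
  frob (semigroupL eps kappa t W x - semigroupL eps kappa t W' x)
    <= expR (- kappa * t) * M.
Proof.
move=> e0 t0 uW uW' WM; rewrite !semigroupLE// -scalerBr frobZ ger0_norm ?expR_ge0//.
(* The hypothesis compares W and W' at equal points only. An arbitrary e > 0 pays for moving the
   argument of W, as [hconv_dist] demands, and drops out because x and sigma coincide on both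
   sides. *)
rewrite ler_wpM2l ?expR_ge0//; apply/ler_addgt0Pr => e e_gt0.
have [K K0 WK] := uW _ e_gt0.
have := @hconv_dist (eps * Num.sqrt (2 * t)) (eps * Num.sqrt (2 * t)) W W' x x (M + e) K.
rewrite !subrr norm10 normr0 mul0r addr0 mulr0 addr0; apply=> // u u'.
apply: le_trans (frob_tri (W u') _ _) _.
by have := WM u'; have := WK u u'; lra.
Qed.

End HeatSemigroup.

(** * Joint continuity of the damped heat semigroup in time and space *)

Section Modulus.
Variable R : realType.

(** The square root is only 1/2-Hölder at 0: u^2 <= 2 |r - r'| for the increment u. Completing a
    square gives eps u <= e + eps^2 u^2 / e, which trades the exponent for the additive e. *)
Lemma sqrt_modulus (eps e : R) : 0 < eps -> 0 < e -> exists2 K, 0 <= K &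
  forall r r', 0 <= r -> 0 <= r' ->
  `|eps * Num.sqrt (2 * r) - eps * Num.sqrt (2 * r')| <= e + K * `|r - r'|.
Proof.
move=> eps0 e0; exists (2 * eps ^+ 2 / e).
  by rewrite divr_ge0 ?ltW// mulr_gt0// exprn_gt0.
move=> r r' r0 r'0; rewrite -mulrBr normrM gtr0_norm//.
have [ra ra'] : 0 <= 2 * r /\ 0 <= 2 * r' by rewrite !mulr_ge0.
set u := `|_ - _|.
have u2 : u ^+ 2 <= 2 * `|r - r'|.
  have -> : 2 * `|r - r'| = u * (Num.sqrt (2 * r) + Num.sqrt (2 * r')).
    rewrite -[Num.sqrt (2 * r) + _]ger0_norm ?addr_ge0 ?sqrtr_ge0//.
    by rewrite -normrM -subr_sqr !sqr_sqrtr// -mulrBr normrM ger0_norm.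
  rewrite expr2; apply: ler_wpM2l; first exact: normr_ge0.
  rewrite /u; apply: le_trans (ler_normB _ _) _.
  by rewrite !ger0_norm ?sqrtr_ge0.
apply: (@le_trans _ _ (e + eps ^+ 2 / e * u ^+ 2)).
  rewrite -(ler_pM2r e0) mulrDl (mulrAC (_ / e)) divfK ?lt0r_neq0//.
  have := sqr_ge0 (eps * u - e / 2); have := sqr_ge0 e; lra.
rewrite lerD2l (_ : 2 * eps ^+ 2 / e * `|r - r'| = eps ^+ 2 / e * (2 * `|r - r'|)).
  by apply: ler_wpM2l => //; rewrite divr_ge0 ?sqr_ge0 ?ltW.
by ring.
Qed.

Lemma expR_lipschitz (kappa r r' : R) : 0 <= kappa -> 0 <= r -> 0 <= r' ->
  `|expR (- kappa * r) - expR (- kappa * r')| <= kappa * `|r - r'|.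
Proof.
move=> k0; wlog rr : r r' / r <= r' => [H r0 r'0|r0 r'0].
  by case/orP: (le_total r r') => rr; [|rewrite distrC (distrC r)]; exact: H.
rewrite [`|r - r'|]ler0_norm ?subr_le0// ger0_norm; last first.
  by rewrite subr_ge0 ler_expR !mulNr lerN2 ler_wpM2l.
have -> : - kappa * r' = - kappa * r + - kappa * (r' - r) by ring.
rewrite expRD -[X in X - _]mulr1 -mulrBr.
apply: (@le_trans _ _ (1 - expR (- kappa * (r' - r)))).
  rewrite ler_piMl// ?subr_ge0 -expR0 ler_expR mulNr oppr_le0 mulr_ge0//.
  by rewrite subr_ge0.
by have := expR_ge1Dx (- kappa * (r' - r)); lra.
Qed.

Variables d m n : nat.

Definition pathcont (T : R) (U : R -> 'rV[R]_d -> 'M[R]_(m, n)) :=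
  forall e : R, 0 < e -> exists2 K, 0 <= K & forall s s' x x',
    0 <= s <= T -> 0 <= s' <= T ->
    frob (U s x - U s' x') <= e + K * (`|s - s'| + norm1 (x - x')).

Lemma pathcont_mucont T U s : pathcont T U -> 0 <= s <= T -> mucont (U s).
Proof.
move=> uU sT e e0; have [K K0 UK] := uU e e0; exists K => // x y.
by have := UK s s x y sT sT; rewrite subrr normr0 add0r.
Qed.

Lemma semigroupL_modulus (eps kappa T M : R) U : 0 < eps -> 0 <= kappa -> 0 <= M ->
  pathcont T U -> (forall s x, 0 <= s <= T -> frob (U s x) <= M) ->
  forall e, 0 < e -> exists2 K, 0 <= K & forall r r' s s' x x',
    0 <= r -> 0 <= r' -> 0 <= s <= T -> 0 <= s' <= T ->
    frob (semigroupL eps kappa r (U s) x - semigroupL eps kappa r' (U s') x') <=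
      e + K * (`|r - r'| + `|s - s'| + norm1 (x - x')).
Proof.
move=> eps0 k0 M0 uU UM e e0; have e2 : 0 < e / 2 by rewrite divr_gt0.
have [K1 K10 UK] := uU _ e2.
set g := gexp (@norm1 R d); have g0 : 0 <= g := gexp_norm1_ge0 R d.
have Kg : 0 < K1 * g + 1 by rewrite ltr_wpDl// mulr_ge0.
(* The width error is later multiplied by K1 g, so this accuracy keeps its constant part below e /
   2; the + 1 in [Kg] keeps the divisor positive. *)
have [K2 K20 sK] := sqrt_modulus eps0 (divr_gt0 e2 Kg).
have kM := mulr_ge0 k0 M0; have Kg0 := mulr_ge0 K10 g0; have KK := mulr_ge0 Kg0 K20.
exists (kappa * M + K1 + K1 * g * K2); first by rewrite !addr_ge0.
move=> r r' s s' x x' r0 r'0 sT s'T.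
have uW := pathcont_mucont uU sT; have uW' := pathcont_mucont uU s'T.
rewrite !semigroupLE//.
have e1 : `|expR (- kappa * r')| <= 1.
  by rewrite ger0_norm ?expR_ge0// -expR0 ler_expR mulNr oppr_le0 mulr_ge0.
have bM : frob (hconv (eps * Num.sqrt (2 * r)) (U s) x) <= M.
  by apply: hconv_bound => // y; exact: UM.
apply: le_trans (frob_comb (expR (- kappa * r)) _ bM e1) _.
have H1 : `|expR (- kappa * r) - expR (- kappa * r')| * M <= kappa * M * `|r - r'|.
  by rewrite mulrAC ler_wpM2r// expR_lipschitz.
have HU u u' : frob (U s u - U s' u') <= (e / 2 + K1 * `|s - s'|) + K1 * norm1 (u - u').
  by rewrite -addrA -mulrDr; exact: UK.
have H2 := hconv_dist (eps * Num.sqrt (2 * r)) (eps * Num.sqrt (2 * r')) x x'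
  uW uW' K10 HU.
rewrite -/g in H2.
have H3 : K1 * g * `|eps * Num.sqrt (2 * r) - eps * Num.sqrt (2 * r')| <=
    e / 2 + K1 * g * K2 * `|r - r'|.
  apply: le_trans (ler_wpM2l Kg0 (sK _ _ r0 r'0)) _.
  rewrite mulrDr (mulrA _ K2) lerD2r mulrA ler_pdivrMr// mulrC.
  by rewrite ler_wpM2l ?ltW// ltrDl.
move: H1 H2 H3.
set a := `|r - r'|; set b := `|s - s'|; set c := norm1 _.
have a0 : 0 <= a := normr_ge0 _.
have b0 : 0 <= b := normr_ge0 _.
have c0 : 0 <= c := norm1_ge0 _.
have := mulr_ge0 kM b0; have := mulr_ge0 kM c0.
have := mulr_ge0 K10 a0; have := mulr_ge0 KK b0; have := mulr_ge0 KK c0.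
lra.
Qed.

End Modulus.

(** * The Duhamel map *)

Section TimeIntegral.
Variable R : realType.
Local Notation mu := (@lebesgue_measure R).

Lemma frob_Rintegral m n (D : set (measurableTypeR R)) (V : R -> 'M[R]_(m, n)) (b : R -> R) :
  measurable D -> (forall i j, mu.-integrable D (EFin \o (fun s => V s i j))) ->
  mu.-integrable D (EFin \o b) -> (forall s, D s -> frob (V s) <= b s) ->
  frob (\matrix_(i, j) Rintegral mu D (fun s => V s i j)) <= Rintegral mu D b.
Proof.
move=> mD; apply: (@frob_functional R R D
  (fun f => mu.-integrable D (EFin \o f)) (fun f => Rintegral mu D f)).
- exact: integrable0.
- by move=> F G iF iG; exact: (integrableD mD iF iG).
- by move=> F G iF iG; exact: RintegralD.
- by move=> a F iF; exact: (integrableZl mD a iF).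
- by move=> a F iF; exact: RintegralZl.
- by move=> F G iF iG FG; exact: le_Rintegral.
Qed.

Lemma Rintegral_cst_itv (x a b : R) (la rb : bool) : a <= b ->
  Rintegral mu [set` Interval (BSide la a) (BSide rb b)] (fun=> x) = x * (b - a).
Proof.
move=> ab; rewrite Rintegral_cst//; congr (_ * _).
transitivity (fine (lebesgue_measure [set` Interval (BSide la a) (BSide rb b)] : \bar R)).
  by [].
rewrite lebesgue_measure_itv/= lte_fin.
by move: ab; rewrite le_eqVlt => /predU1P[->|->] /=; rewrite ?ltxx ?subrr.
Qed.

Lemma modulus_integrable (a b : R) (f : R -> R) :
  (forall e, 0 < e -> exists2 K, 0 <= K & forall s s', a <= s <= b -> a <= s' <= b ->
    `|f s - f s'| <= e + K * `|s - s'|) ->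
  mu.-integrable `[a, b] (EFin \o f).
Proof.
move=> uf; apply: continuous_compact_integrable; first exact: segment_compact.
apply/subspace_continuousP => x /=; rewrite in_itv/= => xab.
apply/cvgrPdist_le => e e0.
have [K K0 fK] := uf (e / 2) (divr_gt0 e0 (ltr0n _ 2)).
have K1 : 0 < K + 1 by rewrite ltr_wpDl.
rewrite near_withinE; near=> y; rewrite /= in_itv/= => yab.
apply: le_trans (fK _ _ xab yab) _.
rewrite [leRHS]splitr lerD2l.
apply: (@le_trans _ _ ((K + 1) * `|x - y|)); first by rewrite ler_wpM2r// lerDl.
rewrite mulrC -ler_pdivlMr//; near: y.
by apply: cvgr_dist_le; [exact: cvg_id|rewrite !divr_gt0].
Unshelve. all: by end_near. Qed.

Lemma Rintegral_increment (f g : R -> R) (t t' : R) : 0 <= t -> t <= t' ->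
  mu.-integrable `[0, t'] (EFin \o f) -> mu.-integrable `[0, t] (EFin \o g) ->
  Rintegral mu `[0, t'] f - Rintegral mu `[0, t] g =
  Rintegral mu `[0, t] (fun s => f s - g s) + Rintegral mu `]t, t'] f.
Proof.
move=> t0 tt' iF iG; rewrite -(Rintegral_itvB iF) ?bnd_simp//.
rewrite RintegralB//; first by rewrite [RHS]addrC addrA subrK.
by apply: integrableS iF => //; apply: subset_itvl; rewrite bnd_simp.
Qed.

Lemma continuous_expR_affine (a b : R) : continuous (fun s : R => expR (a * s + b)).
Proof.
move=> s; apply: (cvg_comp _ expR); last exact: continuous_expR.
by apply: cvgD; [apply: cvgMr; exact: cvg_id|exact: cvg_cst].
Qed.

Lemma integrable_expR_affine (c a b t : R) :
  mu.-integrable `[0, t] (EFin \o (fun s => c * expR (a * s + b))).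
Proof.
apply: continuous_compact_integrable; first exact: segment_compact.
apply: continuous_subspaceT => s.
by apply: cvgMr; exact: continuous_expR_affine.
Qed.

Lemma Rintegral_expR_affine (a b t : R) : 0 <= t ->
  Rintegral mu `[0, t] (fun s => a * expR (a * s + b)) = expR (a * t + b) - expR b.
Proof.
rewrite le_eqVlt => /predU1P[<-|t0].
  by rewrite set_itv1 Rintegral_set1 mulr0 add0r subrr.
have dF (s : R) : is_derive s (1 : R) (fun s : R => expR (a * s + b)) (a * expR (a * s + b)).
  by apply: is_derive_eq; rewrite ?scaler0 ?addr0 ?add0r/= /GRing.scale/=; ring.
rewrite /Rintegral (@continuous_FTC2 R _ (fun s => expR (a * s + b)))//=.
- by rewrite mulr0 add0r.
- apply: continuous_subspaceT => s; apply: cvgMr; exact: continuous_expR_affine.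
- split=> [s _||].
  + exact: ex_derive.
  + exact/cvg_at_right_filter/continuous_expR_affine.
  + exact/cvg_at_left_filter/continuous_expR_affine.
- by move=> s _; rewrite derive1E derive_val.
Qed.

End TimeIntegral.

Section Duhamel.
Variables (R : realType) (d m1 m2 : nat) (L : 'rV[R]_d) (eps T kappa : R)
  (U0 : 'rV[R]_d -> 'M[R]_(m1, m2)).
Hypotheses (eps_gt0 : 0 < eps) (T_gt0 : 0 < T) (m2_gt0 : (1 <= m2)%N)
  (kappaP : (3 * m2 + 1)%:R <= kappa).
Local Notation mu := (@lebesgue_measure R).
Local Notation path := (R -> 'rV[R]_d -> 'M[R]_(m1, m2)).
Local Notation rho := (Num.sqrt m2%:R : R).

Let kappa2 : 2 <= kappa.
Proof.
apply: le_trans kappaP; rewrite ler_nat addn1 ltnS.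
by rewrite (leq_trans _ (leq_pmulr 3 m2_gt0)).
Qed.

Let kappam : m2%:R <= kappa.
Proof. by apply: le_trans kappaP; rewrite ler_nat addn1 ltnW// ltnS leq_pmull. Qed.

Let kappa0 : 0 <= kappa. Proof. exact: le_trans kappa2. Qed.

Definition admissible (U : path) := [/\ pathcont T U,
  forall t x, 0 <= t <= T -> frob (U t x) <= rho &
  forall t, 0 <= t <= T -> Defs.periodic L (U t)].

Definition NU (U : path) : path := fun s y => Nop kappa (U s y).

Definition lip : R := kappa + 1 + 3 * m2%:R.

Lemma lip_gt0 : 0 < lip.
Proof. by rewrite /lip -addrA ltr_wpDl// ltr_wpDr// mulr_ge0. Qed.

Lemma NU_bound U s x : admissible U -> 0 <= s <= T -> frob (NU U s x) <= kappa * rho.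
Proof. by move=> [_ bU _] sT; apply: frob_Nop => //; exact: bU. Qed.

Lemma NU_lipschitz U V s s' x x' : admissible U -> admissible V ->
  0 <= s <= T -> 0 <= s' <= T ->
  frob (NU U s x - NU V s' x') <= lip * frob (U s x - V s' x').
Proof.
by move=> [_ bU _] [_ bV _] sT s'T; apply: Nop_lipschitz => //; [exact: bU|exact: bV].
Qed.

Lemma NU_pathcont U : admissible U -> pathcont T (NU U).
Proof.
move=> aU e e0; have [uU _ _] := aU; have l0 := lip_gt0.
have [K K0 UK] := uU _ (divr_gt0 e0 l0).
exists (lip * K); first by rewrite mulr_ge0// ltW.
move=> s s' x x' sT s'T; apply: le_trans (NU_lipschitz _ _ aU aU sT s'T) _.
apply: le_trans (ler_wpM2l (ltW l0) (UK _ _ x x' sT s'T)) _.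
by rewrite mulrDr mulrCA divff ?lt0r_neq0// mulr1 mulrA.
Qed.

Let rho0 : 0 <= rho. Proof. exact: sqrtr_ge0. Qed.

Definition flow (U : path) t x s := semigroupL eps kappa (t - s) (NU U s) x.

Definition duhamel (U : path) t x : 'M[R]_(m1, m2) :=
  \matrix_(i, j) Rintegral mu `[0, t] (fun s => flow U t x s i j).

Lemma duhamelE U t x i j :
  duhamel U t x i j = Rintegral mu `[0, t] (fun s => flow U t x s i j).
Proof. by rewrite mxE. Qed.

Definition picard (U : path) : path := fun t x =>
  semigroupL eps kappa t U0 x + duhamel U t x.

Lemma flow_modulus U e : admissible U -> 0 < e -> exists2 K, 0 <= K &
  forall t t' s s' x x', 0 <= s <= t -> 0 <= s' <= t' -> t <= T -> t' <= T ->
  frob (flow U t x s - flow U t' x' s') <=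
    e + K * (`|t - t'| + `|s - s'| + norm1 (x - x')).
Proof.
move=> aU e0.
have [K K0 SK] := semigroupL_modulus eps_gt0 kappa0 (mulr_ge0 kappa0 rho0)
  (NU_pathcont aU) (fun s x => @NU_bound U s x aU) e0.
(* The time s enters both through the elapsed time t - s and through U s, so |s - s'| is counted
   twice. *)
exists (2 * K); first exact: mulr_ge0.
move=> t t' s s' x x' /andP[s0 st] /andP[s'0 s't'] tT t'T.
apply: le_trans (SK _ _ s s' x x' _ _ _ _) _; rewrite ?subr_ge0 ?s0 ?s'0//=.
- exact: le_trans tT.
- exact: le_trans t'T.
rewrite lerD2l (mulrC 2) -[leRHS]mulrA ler_wpM2l//.
have : `|t - s - (t' - s')| <= `|t - t'| + `|s - s'|.
  rewrite (_ : _ - _ = (t - t') - (s - s')); [exact: ler_normB|ring].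
have := norm1_ge0 (x - x'); have := normr_ge0 (t - t'); have := normr_ge0 (s - s').
lra.
Qed.

Lemma flow_integrable U t' t x i j : admissible U -> t' <= t -> t <= T ->
  mu.-integrable `[0, t'] (EFin \o (fun s => flow U t x s i j)).
Proof.
move=> aU t't tT; apply: modulus_integrable => e e0.
have [K K0 FK] := flow_modulus aU e0; exists K => // s s' /andP[s0 st] /andP[s'0 s't].
have := FK t t s s' x x; rewrite s0 s'0 !(le_trans _ t't)//= => /(_ _ _ _ _).
rewrite (subrr t) (subrr x) normr0 norm10 add0r addr0 => H; apply: le_trans (H _ _ _ _) => //.
by have := entry_le_frob (flow U t x s - flow U t x s') i j; rewrite entryB.
Qed.

(** The bound kappa rho e^{-kappa (t - s)} is arranged as rho times an exact s-derivative, ready for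
    the fundamental theorem of calculus. *)
Lemma flow_bound U t x s : admissible U -> 0 <= s <= t -> t <= T ->
  frob (flow U t x s) <= rho * (kappa * expR (kappa * s + - (kappa * t))).
Proof.
move=> aU /andP[s0 st] tT; have sT : 0 <= s <= T by rewrite s0 (le_trans st).
apply: le_trans (@frob_semigroupL R d m1 m2 eps kappa (t - s) (NU U s) x
  (kappa * rho) eps_gt0 _ _ _) _.
- by rewrite subr_ge0.
- exact: pathcont_mucont (NU_pathcont aU) sT.
- by move=> y; exact: NU_bound.
rewrite mulrC (mulrC kappa) -mulrA (_ : - kappa * (t - s) = kappa * s + - (kappa * t))//.
ring.
Qed.

Lemma duhamel_bound U t x : admissible U -> 0 <= t <= T ->
  frob (duhamel U t x) <= rho * (1 - expR (- kappa * t)).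
Proof.
move=> aU /andP[t0 tT].
apply: le_trans (frob_Rintegral (b := fun s =>
    rho * (kappa * expR (kappa * s + - (kappa * t)))) _ _ _ _) _ => //.
- by move=> i j; exact: flow_integrable.
- exact: (integrableZl _ rho (integrable_expR_affine kappa kappa _ t)).
- by move=> s /=; rewrite in_itv => /= st; exact: flow_bound.
rewrite RintegralZl//; last exact: integrable_expR_affine.
by rewrite Rintegral_expR_affine// subrr expR0 mulNr.
Qed.

(** A free constant C replaces the weighted supremum norm: iterating the lemma halves C, and no
    supremum has to be formed. *)
Lemma picard_contraction U V C : admissible U -> admissible V -> 0 <= C ->
  (forall s x, 0 <= s <= T -> frob (U s x - V s x) <= C * expR (2 * lip * s)) ->
  forall t x, 0 <= t <= T ->
  frob (picard U t x - picard V t x) <= C / 2 * expR (2 * lip * t).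
Proof.
move=> aU aV C0 UV t x /andP[t0 tT]; have l0 := lip_gt0.
have -> : picard U t x - picard V t x =
    \matrix_(i, j) Rintegral mu `[0, t] (fun s => (flow U t x s - flow V t x s) i j).
  rewrite /picard opprD addrACA subrr add0r; apply/matrixP => i j; rewrite !mxE.
  rewrite -RintegralB//; [|exact: flow_integrable..].
  by apply: eq_Rintegral => s _; rewrite entryB.
apply: le_trans (frob_Rintegral (b := fun s =>
    C / 2 * (2 * lip * expR (2 * lip * s + 0))) _ _ _ _) _ => //.
- move=> i j; under [X in EFin \o X]eq_fun do rewrite entryB.
  exact: (integrableB _ (flow_integrable x i j aU (lexx t) tT)
    (flow_integrable x i j aV (lexx t) tT)).
- exact: (integrableZl _ (C / 2) (integrable_expR_affine (2 * lip) (2 * lip) 0 t)).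
- move=> s /=; rewrite in_itv => /= /andP[s0 st].
  have sT : 0 <= s <= T by rewrite s0 (le_trans st).
  apply: le_trans (@frob_semigroupLB R d m1 m2 eps kappa (t - s) (NU U s) (NU V s) x
    (lip * (C * expR (2 * lip * s))) eps_gt0 _ _ _ _) _.
  + by rewrite subr_ge0.
  + exact: pathcont_mucont (NU_pathcont aU) sT.
  + exact: pathcont_mucont (NU_pathcont aV) sT.
  + move=> y; apply: le_trans (NU_lipschitz y y aU aV sT sT) _.
    by rewrite ler_wpM2l ?(ltW l0)// UV.
  rewrite addr0 (_ : C / 2 * _ = lip * (C * expR (2 * lip * s))); last by field.
  (* Here the damping e^{-kappa (t - s)} is just bounded by 1; the gain of 1/2 comes from
     integrating the weight alone. *)
  rewrite ler_piMl//; first by rewrite mulr_ge0 ?(ltW l0)// mulr_ge0 ?expR_ge0.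
  by rewrite -expR0 ler_expR mulNr oppr_le0 mulr_ge0// subr_ge0.
rewrite RintegralZl//; last exact: integrable_expR_affine.
rewrite Rintegral_expR_affine// addr0 expR0 ler_wpM2l ?divr_ge0//.
by rewrite lerBlDr lerDl.
Qed.

(** Splits [0, t'] at t: the integrands are compared on the common part, and the remaining piece is
    short with integrand at most kappa rho. *)
Lemma duhamel_increment U t t' x x' eta : admissible U -> 0 <= t -> t <= t' -> t' <= T ->
  (forall s, 0 <= s <= t -> frob (flow U t' x' s - flow U t x s) <= eta) ->
  frob (duhamel U t' x' - duhamel U t x) <= eta * t + kappa * rho * (t' - t).
Proof.
move=> aU t0 tt' t'T Ueta; have tT := le_trans tt' t'T.
have iF i j := flow_integrable x' i j aU (lexx t') t'T.
have iFt i j := flow_integrable x' i j aU tt' t'T.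
have iG i j := flow_integrable x i j aU (lexx t) tT.
pose A : 'M[R]_(m1, m2) :=
  \matrix_(i, j) Rintegral mu `[0, t] (fun s => (flow U t' x' s - flow U t x s) i j).
pose B : 'M[R]_(m1, m2) :=
  \matrix_(i, j) Rintegral mu `]t, t'] (fun s => flow U t' x' s i j).
have -> : duhamel U t' x' - duhamel U t x = A + B.
  apply/matrixP => i j.
  have AE : A i j = Rintegral mu `[0, t] (fun s => flow U t' x' s i j - flow U t x s i j).
    by rewrite mxE; congr (Rintegral mu _ _); apply/funext => s; exact: entryB.
  have BE : B i j = Rintegral mu `]t, t'] (fun s => flow U t' x' s i j) by rewrite mxE.
  have AB : (A + B) i j = A i j + B i j by rewrite mxE.
  rewrite AB AE BE; apply: etrans (entryB _ _ i j) _.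
  apply: etrans (Rintegral_increment t0 tt' (iF i j) (iG i j)).
  exact: congr2 (duhamelE U t' x' i j) (congr1 -%R (duhamelE U t x i j)).
apply: le_trans (frobD _ _) (lerD _ _).
- apply: le_trans (frob_Rintegral (b := fun=> eta) _ _ _ _) _ => //.
  + move=> i j; under [X in EFin \o X]eq_fun do rewrite entryB.
    exact: (integrableB _ (iFt i j) (iG i j)).
  + apply: modulus_integrable => e e0; exists 0 => // s s' _ _.
    by rewrite subrr normr0 mul0r addr0 ltW.
  by rewrite (Rintegral_cst_itv eta true false t0) subr0.
- apply: le_trans (frob_Rintegral (b := fun=> kappa * rho) _ _ _ _) _ => //.
  + move=> i j; apply: integrableS (iF i j) => // s /=; rewrite !in_itv /=.
    by move=> /andP[ts ->]; rewrite (le_trans t0) ?ltW.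
  + apply: (@integrableS _ _ _ mu `[t, t']) => //.
      by move=> s /=; rewrite !in_itv /= => /andP[/ltW -> ->].
    apply: modulus_integrable => e e0; exists 0 => // s s' _ _.
    by rewrite subrr normr0 mul0r addr0 ltW.
  + move=> s /=; rewrite in_itv => /= /andP[/ltW ts st'].
    have st : 0 <= s <= t' by rewrite st' (le_trans t0).
    apply: le_trans (flow_bound x' aU st t'T) _.
    rewrite mulrCA mulrA ler_piMr ?mulr_ge0//.
    by rewrite -expR0 ler_expR subr_le0 ler_wpM2l.
  by rewrite (Rintegral_cst_itv (kappa * rho) false false tt').
Qed.

(** The initial datum is treated as a constant path, so that the estimates for paths also govern the
    free evolution e^{tL} U0. *)
Lemma picard_admissible U : admissible (fun=> U0) -> admissible U ->
  admissible (picard U).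
Proof.
move=> aU0 aU; have T0 : (0 : R) <= 0 <= T by rewrite lexx ltW.
have uU0 : mucont U0 by case: aU0 => uU0 _ _; exact: (pathcont_mucont uU0 T0).
have bU0 y : frob (U0 y) <= rho by case: aU0 => _ bU0 _; exact: (bU0 0 y T0).
have pU0 : Defs.periodic L U0 by case: aU0 => _ _ pU0; exact: (pU0 0 T0).
have perS r (W : 'rV[R]_d -> 'M[R]_(m1, m2)) : 0 <= r -> mucont W -> Defs.periodic L W ->
    Defs.periodic L (semigroupL eps kappa r W).
  move=> r0 uW pW x k; rewrite !semigroupLE//; congr (_ *: _).
  apply/matrixP => i j; rewrite !mxE; congr gexp; apply/funext => z.
  by rewrite addrAC pW.
split.
- move=> e e0; have e2 : 0 < e / 2 by rewrite divr_gt0.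
  have [uP0 _ _] := aU0.
  have [K1 K10 SK] := semigroupL_modulus eps_gt0 kappa0 rho0 uP0
    (fun s x _ => bU0 x) e2.
  (* Integration over a time at most T multiplies the pointwise error by T, hence the accuracy e / 2
     / T. *)
  have [K2 K20 FK] := flow_modulus aU (divr_gt0 e2 T_gt0).
  have kr : 0 <= kappa * rho by exact: mulr_ge0.
  have KT : 0 <= K2 * T by rewrite mulr_ge0// ltW.
  exists (K1 + K2 * T + kappa * rho); first by rewrite !addr_ge0.
  move=> s s' x x'.
  wlog ss' : s s' x x' / s <= s' => [H sT s'T|/andP[s0 sT] /andP[s'0 s'T]].
    case/orP: (le_total s s') => ss'; first exact: H.
    rewrite frobBC distrC -(norm1N (x - x')) opprB; exact: H.
  rewrite /picard opprD addrACA; apply: le_trans (frobD _ _) _.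
  have H1 := SK s s' 0 0 x x' s0 s'0 T0 T0.
  rewrite subrr normr0 addr0 in H1.
  have H2 := @duhamel_increment U s s' x x'
    (e / 2 / T + K2 * (`|s - s'| + norm1 (x - x'))) aU s0 ss' s'T _.
  have {}H2 := H2 _.
  rewrite frobBC in H2.
  have H3 : (e / 2 / T + K2 * (`|s - s'| + norm1 (x - x'))) * s <=
      e / 2 + K2 * T * (`|s - s'| + norm1 (x - x')).
    apply: (@le_trans _ _ ((e / 2 / T + K2 * (`|s - s'| + norm1 (x - x'))) * T)).
      apply: ler_wpM2l; last exact: (le_trans ss' s'T).
      apply: addr_ge0; first exact: divr_ge0 (ltW e2) (ltW T_gt0).
      by rewrite mulr_ge0// addr_ge0 ?norm1_ge0.
    by rewrite mulrDl divfK ?lt0r_neq0// mulrAC.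
  have H4 : kappa * rho * (s' - s) <= kappa * rho * (`|s - s'| + norm1 (x - x')).
    rewrite ler_wpM2l// distrC ger0_norm ?subr_ge0//.
    by rewrite lerDl norm1_ge0.
  apply: (le_trans (lerD H1 (H2 _))) => [r /andP[r0 rs]|].
    have := FK s' s r r x' x; rewrite r0 rs (le_trans rs ss') => /(_ isT isT s'T sT).
    by rewrite subrr normr0 addr0 distrC -(norm1N (x' - x)) opprB.
  lra.
- move=> t x tT; have /andP[t0 _] := tT; apply: le_trans (frobD _ _) _.
  apply: (le_trans (lerD (frob_semigroupL kappa x eps_gt0 t0 uU0 bU0)
    (duhamel_bound x aU tT))).
  (* The free part contributes rho e^{-kappa t} and the Duhamel part rho (1 - e^{-kappa t}); they
     add up to exactly rho. *)
  by rewrite mulrBr mulr1 (mulrC (expR _)) addrCA subrr addr0.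
- move=> t /andP[t0 tT] x k.
  suff DP : duhamel U t (x + L 0 k *: delta_mx 0 k) = duhamel U t x.
    exact: congr2 (perS t U0 t0 uU0 pU0 x k) DP.
  apply/matrixP => i j; apply: etrans (duhamelE _ _ _ i j) _.
  apply: etrans (esym (duhamelE _ _ _ i j)); apply: eq_Rintegral => s.
  rewrite inE /= in_itv => /= /andP[s0 st].
  have sT : 0 <= s <= T by rewrite s0 (le_trans st).
  have pN : Defs.periodic L (NU U s).
    by move=> y l; case: aU => _ _ pU; rewrite /NU (pU s sT).
  have ts : 0 <= t - s by rewrite subr_ge0.
  have uN := pathcont_mucont (NU_pathcont aU) sT.
  have E := perS _ _ ts uN pN x k.
  by rewrite /flow E.
Qed.

End Duhamel.

(** * Compactness of the period box *)

Section Compactness.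
Variable R : realType.

Lemma sqrt_sqnorm_le n (z : 'rV[R]_n) : Num.sqrt (sqnorm z) <= norm1 z.
Proof.
rewrite -(@ler_pXn2r _ 2)// ?nnegrE ?sqrtr_ge0 ?norm1_ge0//.
rewrite sqr_sqrtr; last by apply: sumr_ge0 => i _; exact: sqr_ge0.
rewrite expr2 {1}/norm1 mulr_suml; apply: ler_sum => i _.
rewrite -real_normK ?num_real// expr2 ler_wpM2l//.
by rewrite /norm1 (bigD1 i)//= lerDl sumr_ge0.
Qed.

Lemma norm1_le_sqnorm n (z : 'rV[R]_n) : norm1 z <= n%:R * Num.sqrt (sqnorm z).
Proof.
rewrite mulr_natl -[X in _ *+ X](card_ord n) -sumr_const; apply: ler_sum => i _.
rewrite -sqrtr_sqr ler_wsqrtr// /sqnorm (bigD1 i)//= lerDl.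
by apply: sumr_ge0 => j _; exact: sqr_ge0.
Qed.

Lemma norm1_nbhs n (z : 'rV[R]_n) (r : R) : 0 < r -> \forall y \near z, norm1 (y - z) < r.
Proof.
move=> r0; apply/nbhs_ballP; exists (r / n.+1%:R) => /=; first by rewrite divr_gt0.
move=> y zy; apply: (@le_lt_trans _ _ (\sum_(i < n) r / n.+1%:R)).
  apply: ler_sum => i _; rewrite !mxE distrC ltW//; exact: (zy.2 0 i).
rewrite sumr_const card_ord -[ltLHS]mulr_natl mulrCA gtr_pMr// ltr_pdivrMr// mul1r.
by rewrite ltr_nat.
Qed.

(** A Lebesgue-number argument: compactness, in its near-covering form along del -> 0+, merges the
    local thresholds r into a single del. *)
Lemma compact_uniform (X : topologicalType) (A : set X) (P : R -> X -> Prop) :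
  compact A ->
  (forall x, A x -> exists2 r : R, 0 < r &
     \forall y \near x, forall del, 0 < del -> del < r -> P del y) ->
  exists2 del : R, 0 < del & forall x, A x -> P del x.
Proof.
move=> /compact_near_coveringP cA loc.
have : \forall del \near (0 : R)^'+, A `<=` P del.
  apply: (cA R (0 : R)^'+ P) => x Ax; have [r r0 Pr] := loc x Ax.
  exists ([set y | forall del, 0 < del -> del < r -> P del y],
          [set del | 0 < del < r]); last first.
    by move=> [y del] /= [Py /andP[del0 delr]]; exact: Py.
  by split=> //=; near=> del; apply/andP; split; near: del;
    [exact: nbhs_right_gt|exact: nbhs_right_lt].
move=> H; near (0 : R)^'+ => del.
exists del; last by near: del; exact: H.
by near: del; exact: nbhs_right_gt.
Unshelve. all: by end_near. Qed.

End Compactness.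

Section PeriodicBox.
Variables (R : realType) (d m n : nat) (a L : 'rV[R]_d).
Hypothesis L_gt0 : forall k, 0 < L 0 k.
Implicit Type W : 'rV[R]_d -> 'M[R]_(m, n).

Lemma periodic_shift W (k : 'rV[int]_d) x : Defs.periodic L W ->
  W (x + \row_i (L 0 i *~ k 0 i)) = W x.
Proof.
move=> pW.
have nat_shift i (q : nat) y : W (y + (L 0 i *+ q) *: delta_mx 0 i) = W y.
  elim: q y => [|q IH] y; first by rewrite scale0r addr0.
  by rewrite mulrS scalerDl addrA IH pW.
have int_shift i (q : int) y : W (y + (L 0 i *~ q) *: delta_mx 0 i) = W y.
  case: q => q; first exact: nat_shift.
  rewrite NegzE mulrNz scaleNr -[in RHS](subrK ((L 0 i *+ q.+1) *: delta_mx 0 i) y).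
  by rewrite nat_shift.
have -> : \row_i (L 0 i *~ k 0 i) = \sum_i (L 0 i *~ k 0 i) *: delta_mx 0 i.
  by rewrite [LHS]row_sum_delta; apply: eq_bigr => i _; rewrite mxE.
by elim/big_rec: _ x => [|i v _ IH] x; rewrite ?addr0// addrA IH int_shift.
Qed.

(** The shift depends on x alone and works for all periodic functions at once, so that two
    functions, or two points, can be moved together. *)
Lemma box_translate x : exists v : 'rV[R]_d, box_closure a L (x + v) /\
  forall W, Defs.periodic L W -> forall y, W (y + v) = W y.
Proof.
pose k : 'rV[int]_d := \row_i (- Num.floor ((x 0 i - a 0 i) / L 0 i)).
exists (\row_i (L 0 i *~ k 0 i)); split; last by move=> W pW y; exact: periodic_shift.
move=> i; rewrite !mxE mulrNz; have L0 := L_gt0 i.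
have := floor_le ((x 0 i - a 0 i) / L 0 i); have := lt_succ_floor ((x 0 i - a 0 i) / L 0 i).
rewrite intrD ltr_pdivrMr// ler_pdivlMr// mulr1z -[L 0 i *~ _]mulrzl.
by move: ((Num.floor _)%:~R) => q H1 H2; apply/andP; split; lra.
Qed.

Lemma box_compact : compact (box_closure a L).
Proof.
have := @rV_compact R d (fun k => `[a 0 k, a 0 k + L 0 k]%classic)
  (fun k => @segment_compact _ _ _).
congr compact; apply/seteqP; split => x /= H k; have := H k; by rewrite in_itv.
Qed.

(** For points at distance at least del, the trivial bound 2 M is at most (2 M / del) times the
    distance. *)
Lemma affine_modulus W (M del e : R) : 0 <= e -> (forall x, frob (W x) <= M) -> 0 < del ->
  (forall x y, norm1 (x - y) < del -> frob (W x - W y) <= e) ->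
  forall x y, frob (W x - W y) <= e + 2 * M / del * norm1 (x - y).
Proof.
move=> e0 WM del0 Wdel x y.
have M0 : 0 <= M := le_trans (frob_ge0 _) (WM x).
have [xy|xy] := ltP (norm1 (x - y)) del.
  apply: le_trans (Wdel _ _ xy) _.
  by rewrite lerDl mulr_ge0 ?norm1_ge0// divr_ge0 ?mulr_ge0// ltW.
apply: le_trans (frobB _ _) _; apply: ler_wpDl => //.
apply: (@le_trans _ _ (2 * M)); first by have := WM x; have := WM y; lra.
by rewrite mulrAC ler_pdivlMr// ler_wpM2l// mulr_ge0.
Qed.

Lemma inX_mucont W M : inX L W -> (forall x, frob (W x) <= M) -> mucont W.
Proof.
move=> [cW pW] WM e e0; have e2 : 0 < e / 2 by rewrite divr_gt0.
(* Only x is confined to the box: a translation bringing x into it may leave a nearby y just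
   outside. *)
have [del del0 Hdel] : exists2 del : R, 0 < del & forall x, box_closure a L x ->
    forall y, norm1 (x - y) < del -> frob (W x - W y) <= e.
  apply: compact_uniform => [|x _]; first exact: box_compact.
  have [r r0 Wr] := cW x _ e2; have r2 : 0 < r / 2 by rewrite divr_gt0.
  exists (r / 2) => //; near=> z => del del0 delr y zy.
  have zx : norm1 (z - x) < r / 2 by near: z; exact: norm1_nbhs.
  have Wz : frob (W z - W x) < e / 2.
    by apply/Wr/(le_lt_trans (sqrt_sqnorm_le _)); lra.
  have Wy : frob (W y - W x) < e / 2.
    apply/Wr/(le_lt_trans (sqrt_sqnorm_le _)).
    have := norm1D (y - z) (z - x); rewrite addrA subrK.
    by rewrite -(norm1N (y - z)) opprB; lra.
  apply: le_trans (frob_tri (W x) _ _) _; rewrite (frobBC (W x)); lra.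
exists (2 * M / del).
  by rewrite divr_ge0 ?(ltW del0)// mulr_ge0// (le_trans (frob_ge0 _) (WM 0)).
apply: affine_modulus => //; first exact: ltW.
move=> x y xy; have [v [bv pv]] := box_translate x.
rewrite -(pv _ pW x) -(pv _ pW y); apply: Hdel => //.
by rewrite opprD addrACA subrr addr0.
Unshelve. all: by end_near. Qed.

Lemma box_bound W M x : Defs.periodic L W ->
  (forall y, box_closure a L y -> frob (W y) <= M) -> frob (W x) <= M.
Proof.
by move=> pW WM; have [v [bv pv]] := box_translate x; rewrite -(pv _ pW x) WM.
Qed.

End PeriodicBox.

Section PathModulus.
Variables (R : realType) (d m1 m2 : nat) (a L : 'rV[R]_d) (T : R).
Hypothesis L_gt0 : forall k, 0 < L 0 k.
Local Notation rho := (Num.sqrt m2%:R : R).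
Implicit Type U : R -> 'rV[R]_d -> 'M[R]_(m1, m2).

Lemma in_CXm_bound U : in_CXm a L T U ->
  forall t x, 0 <= t <= T -> frob (U t x) <= rho.
Proof.
move=> [Um _] t x tT; have [[_ pU] bU] := Um t tT.
exact: (box_bound L_gt0 x pU bU).
Qed.

Lemma in_CXm_pathcont U : in_CXm a L T U -> pathcont T U.
Proof.
move=> CU; have bU := in_CXm_bound CU; have [Um Ut] := CU.
have rho0 : 0 <= rho by exact: sqrtr_ge0.
have mU t : 0 <= t <= T -> mucont (U t).
  by move=> tT; apply: (inX_mucont a L_gt0 (M := rho) (Um t tT).1) => x; exact: bU.
move=> e e0; have e3 : 0 < e / 3 by rewrite divr_gt0.
have e6 : 0 < e / 6 by rewrite divr_gt0.
(* The guard on s is repeated inside the predicate because [compact_uniform] tests it on a full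
   neighbourhood of t, which may leave [0, T]. *)
have [del del0 Hdel] : exists2 del : R, 0 < del & forall s, `[0, T]%classic s ->
    0 <= s <= T -> forall s' x x', 0 <= s' <= T -> `|s - s'| < del ->
    norm1 (x - x') < del -> frob (U s x - U s' x') <= e.
  apply: compact_uniform => [|t]; first exact: segment_compact.
  rewrite /= in_itv /= => tT.
  have glob s (v : R) : 0 <= s <= T ->
      (forall x, box_closure a L x -> frob (U s x - U t x) < v) ->
      forall x, frob (U s x - U t x) < v.
    move=> sT Hv x; have [w [bw pw]] := box_translate m1 m2 a L_gt0 x.
    rewrite -(pw _ (Um s sT).1.2 x) -(pw _ (Um t tT).1.2 x); exact: Hv.
  have [r r0 Hr] := Ut t tT _ e3.
  have [K K0 UK] := mU t tT _ e6.
  have K1 : 0 < K + 1 by rewrite ltr_wpDl.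
  (* The first threshold puts both s and s' within r of t, costing e / 3 each; the second keeps the
     spatial term K * norm1 (x - x') below e / 6, which with the e / 6 from [UK] completes e. *)
  exists (Num.min (r / 2) (e / 6 / (K + 1))).
    by rewrite lt_min !divr_gt0.
  near=> s => del del0; rewrite lt_min => /andP[delr delK] sT s' x x' s'T ss' xx'.
  have st : `|s - t| < r / 2.
    by rewrite distrC; near: s; apply: cvgr_dist_lt; [exact: cvg_id|rewrite divr_gt0].
  have H1 := glob s _ sT (Hr s sT _) x.
  have H2 := glob s' _ s'T (Hr s' s'T _) x'.
  have {}H1 := H1 (lt_trans st _).
  have {}H2 : frob (U s' x' - U t x') < e / 3.
    apply: H2; have := ler_normD (s' - s) (s - t); rewrite addrA subrK (distrC s' s); lra.
  have {}H1 : frob (U s x - U t x) < e / 3 by apply: H1; lra.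
  have H3 : K * norm1 (x - x') <= e / 6.
    apply: (@le_trans _ _ ((K + 1) * (e / 6 / (K + 1)))).
      by rewrite ler_pM ?norm1_ge0// ?lerDl// ltW// (lt_trans xx').
    by rewrite mulrCA divff ?mulr1// lt0r_neq0.
  have := UK x x'; have := frob_tri (U t x) (U s x) (U s' x').
  have := frob_tri (U t x') (U t x) (U s' x'); rewrite (frobBC (U t x')).
  lra.
exists (2 * rho / del); first by rewrite divr_ge0 ?(ltW del0)// mulr_ge0.
move=> s s' x x' sT s'T; pose q := `|s - s'| + norm1 (x - x').
rewrite -/q; have q1 : `|s - s'| <= q by rewrite lerDl norm1_ge0.
have q2 : norm1 (x - x') <= q by rewrite lerDr.
have [qdel|qdel] := ltP q del.
  apply: (@le_trans _ _ e).
    by apply: Hdel => //; exact: le_lt_trans qdel.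
  by rewrite lerDl mulr_ge0 ?addr_ge0 ?norm1_ge0// divr_ge0 ?mulr_ge0// ltW.
apply: le_trans (frobB _ _) _; apply: ler_wpDl; first exact: ltW.
apply: (@le_trans _ _ (2 * rho)).
  by have := bU s x sT; have := bU s' x' s'T; lra.
by rewrite mulrAC ler_pdivlMr// ler_wpM2l// mulr_ge0.
Unshelve. all: by end_near. Qed.

End PathModulus.

(** * Fixed points of the Duhamel map *)

Section GeometricLimit.
Variable R : realType.

Lemma geometric_small (B e : R) : 0 <= B -> 0 < e -> exists n : nat, B / 2 ^+ n < e.
Proof.
move=> B0 e0; exists (Num.bound (B / e)).
rewrite ltr_pdivrMr ?exprn_gt0// mulrC -ltr_pdivrMr//.
apply: lt_trans (archi_boundP (divr_ge0 B0 (ltW e0))) _.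
by rewrite -natrX ltr_nat ltn_expl.
Qed.

Lemma geometric_le0 (B x : R) : 0 <= B -> (forall n : nat, x <= B / 2 ^+ n) -> x <= 0.
Proof.
move=> B0 xB; apply/ler_addgt0Pr => e e0; rewrite add0r.
by have [n Bn] := geometric_small B0 e0; exact: le_trans (xB n) (ltW Bn).
Qed.

(* The intervals of radius 2 C / 2^n centred at u n are nested, so the supremum of
   their left endpoints lies in all of them. *)
Lemma geometric_limit (u : nat -> R) (C : R) :
  (forall n, `|u n.+1 - u n| <= C / 2 ^+ n) ->
  exists l, forall n, `|u n - l| <= 2 * (C / 2 ^+ n).
Proof.
move=> uC; pose c n : R := C / 2 ^+ n.
have cS n : c n = 2 * c n.+1 by rewrite /c exprS; field; rewrite expf_neq0.
pose lo n := u n - 2 * c n; pose hi n := u n + 2 * c n.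
have lo_nd : {homo lo : n m / (n <= m)%N >-> n <= m}.
  apply: homo_leq; [exact: lexx|exact: le_trans|move=> n].
  by have := uC n; rewrite -/(c n) ler_norml /lo => /andP[]; have := cS n; lra.
have hi_ni : {homo hi : n m / (n <= m)%N >-> n >= m}.
  apply: homo_leq; [exact: lexx|by move=> x y z xy yz; exact: le_trans yz xy|move=> n].
  by have := uC n; rewrite -/(c n) ler_norml /hi => /andP[]; have := cS n; lra.
have c0 n : 0 <= c n := le_trans (normr_ge0 _) (uC n).
have lohi n m : lo n <= hi m.
  apply: le_trans (lo_nd _ _ (leq_maxl n m)) _.
  apply: le_trans (hi_ni _ _ (leq_maxr n m)).
  by rewrite /lo /hi; have := c0 (maxn n m); lra.
exists (sup (range lo)) => n; rewrite -/(c n) ler_norml.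
have H1 : lo n <= sup (range lo).
  by apply: ub_le_sup; [exists (hi 0%N) => _ [m _ <-]|exists n].
have H2 : sup (range lo) <= hi n.
  by apply: ge_sup; [exists (lo 0%N); exists 0%N|move=> _ [m _ <-]].
by move: H1 H2; rewrite /lo /hi => H1 H2; apply/andP; split; lra.
Qed.

End GeometricLimit.

Section Existence.
Variables (R : realType) (d m1 m2 : nat) (a L : 'rV[R]_d) (eps T kappa : R)
  (U0 : 'rV[R]_d -> 'M[R]_(m1, m2)).
Hypotheses (eps_gt0 : 0 < eps) (T_gt0 : 0 < T) (m2_gt0 : (1 <= m2)%N)
  (kappaP : (3 * m2 + 1)%:R <= kappa) (L_gt0 : forall k, 0 < L 0 k).
Local Notation path := (R -> 'rV[R]_d -> 'M[R]_(m1, m2)).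
Local Notation rho := (Num.sqrt m2%:R : R).
Local Notation admissible := (@admissible R d m1 m2 L T).
Local Notation picard := (picard eps kappa U0).
Local Notation lam := (2 * lip m2 kappa).

Lemma in_CXm_admissible U : in_CXm a L T U -> admissible U.
Proof.
move=> CU; split; first exact: in_CXm_pathcont CU.
- exact: in_CXm_bound CU.
- by move=> t tT; exact: ((CU.1 t tT).1).2.
Qed.

Lemma admissible_in_CXm U : admissible U -> in_CXm a L T U.
Proof.
move=> [uU bU pU]; split=> [t tT|t tT e e0].
  split; last by move=> x _; exact: bU.
  split; last exact: pU.
  move=> x e e0; have e2 : 0 < e / 2 by rewrite divr_gt0.
  have [K K0 UK] := pathcont_mucont uU tT e2.
  have Kd : 0 <= K * d%:R by exact: mulr_ge0.
  have K1 : 0 < K * d%:R + 1 by rewrite ltr_wpDl.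
  exists (e / 2 / (K * d%:R + 1)); first by rewrite divr_gt0.
  move=> y; rewrite ltr_pdivlMr// => yx; apply: le_lt_trans (UK _ _) _.
  have := ler_wpM2l K0 (norm1_le_sqnorm (y - x)).
  have := sqrtr_ge0 (sqnorm (y - x)); lra.
have e2 : 0 < e / 2 by rewrite divr_gt0.
have [K K0 UK] := uU _ e2; have K1 : 0 < K + 1 by rewrite ltr_wpDl.
exists (e / 2 / (K + 1)); first by rewrite divr_gt0.
move=> s sT; rewrite ltr_pdivlMr// => st x _; apply: le_lt_trans (UK s t x x sT tT) _.
rewrite subrr norm10 addr0; have := normr_ge0 (s - t); lra.
Qed.

Let rho0 : 0 <= rho. Proof. exact: sqrtr_ge0. Qed.

Let lam_ge0 : 0 <= lam.
Proof. by rewrite mulr_ge0// ltW// lip_gt0. Qed.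

(** Both paths lie in the ball, so their distance starts below 2 rho; being fixed, they may be
    passed through the contraction again and again until the bound vanishes. *)
Lemma fixed_point_unique U V : admissible U -> admissible V ->
  (forall t x, 0 <= t <= T -> U t x = picard U t x) ->
  (forall t x, 0 <= t <= T -> V t x = picard V t x) ->
  forall t x, 0 <= t <= T -> V t x = U t x.
Proof.
move=> aU aV fU fV t x tT.
have H (n : nat) s y : 0 <= s <= T ->
    frob (U s y - V s y) <= 2 * rho / 2 ^+ n * expR (lam * s).
  elim: n s y => [|n IH] s y sT.
    rewrite expr0 divr1; apply: (@le_trans _ _ (2 * rho)).
      apply: le_trans (frobB _ _) _; case: aU aV => _ bU _ [_ bV _].
      by have := bU s y sT; have := bV s y sT; lra.
    rewrite ler_peMr ?mulr_ge0// -[leLHS]expR0 ler_expR mulr_ge0//.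
    by case/andP: sT.
  rewrite fU// fV// exprS (_ : 2 * rho / (2 * 2 ^+ n) = 2 * rho / 2 ^+ n / 2).
    by apply: (picard_contraction _ eps_gt0 m2_gt0 kappaP aU aV) => //.
  by field; rewrite expf_neq0.
apply/eqP; rewrite eq_sym -subr_eq0; apply/eqP/frob_eq0/eqP.
rewrite eq_le frob_ge0 andbT.
apply: (@geometric_le0 _ (2 * rho * expR (lam * t))).
  by rewrite mulr_ge0 ?expR_ge0// mulr_ge0.
by move=> n; rewrite mulrAC; exact: H.
Qed.

Lemma fixed_point_exists : admissible (fun=> U0) ->
  exists2 U, admissible U & forall t x, 0 <= t <= T -> U t x = picard U t x.
Proof.
move=> aU0; pose u n : path := iter n picard (fun=> U0).
have au n : admissible (u n).
  by elim: n => [//|n IH]; exact: (picard_admissible eps_gt0 T_gt0 m2_gt0 kappaP).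
pose G := expR (lam * T); have G0 : 0 <= G := expR_ge0 _.
have expG s : 0 <= s <= T -> 1 <= expR (lam * s) <= G.
  by move=> /andP[s0 sT]; rewrite -{1}expR0 !ler_expR mulr_ge0//= ler_wpM2l.
pose E := 2 * rho * G; have E0 : 0 <= E by rewrite !mulr_ge0.
have uS (n : nat) s y : 0 <= s <= T ->
    frob (u n.+1 s y - u n s y) <= 2 * rho / 2 ^+ n * expR (lam * s).
  elim: n s y => [|n IH] s y sT.
    rewrite expr0 divr1; apply: (@le_trans _ _ (2 * rho)).
      apply: le_trans (frobB _ _) _; case: (au 0%N) (au 1%N) => _ b0 _ [_ b1 _].
      by have := b0 s y sT; have := b1 s y sT; lra.
    by rewrite ler_peMr ?mulr_ge0//; case/andP: (expG s sT).
  rewrite exprS (_ : 2 * rho / (2 * 2 ^+ n) = 2 * rho / 2 ^+ n / 2).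
    by apply: (picard_contraction _ eps_gt0 m2_gt0 kappaP (au n.+1) (au n)) => //.
  by field; rewrite expf_neq0.
(* The limit is chosen as a function of the sequence alone, so equal sequences have equal limits;
   this is how periodicity passes to U. *)
pose glim (v : nat -> R) := get [set l | forall n, `|v n - l| <= 2 * (E / 2 ^+ n)].
have glimP v : (exists l, forall n, `|v n - l| <= 2 * (E / 2 ^+ n)) ->
    forall n, `|v n - glim v| <= 2 * (E / 2 ^+ n).
  by move=> H; exact: (getPex H).
pose U : path := fun t x => \matrix_(i, j) glim (fun n => u n t x i j).
(* The factor m1 m2 comes from passing from entries to the Frobenius norm, the 2 from the geometric
   tail, and E already bounds the weight by its value at T. *)
pose B := (m1 * m2)%:R * (2 * E); have B0 : 0 <= B by rewrite !mulr_ge0.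
have uU n t x : 0 <= t <= T -> frob (u n t x - U t x) <= B / 2 ^+ n.
  move=> tT; rewrite (_ : B / 2 ^+ n = (m1 * m2)%:R * (2 * (E / 2 ^+ n)));
    last by rewrite /B; ring.
  apply: frob_le_sum => [|i j].
    by rewrite !mulr_ge0// invr_ge0 exprn_ge0.
  rewrite entryB [U t x i j]mxE; apply: (glimP (fun n => u n t x i j)).
  apply: geometric_limit => {}n; rewrite -entryB.
  apply: le_trans (entry_le_frob _ _ _) (le_trans (uS n t x tT) _).
  rewrite /E mulrAC ler_wpM2r ?invr_ge0 ?exprn_ge0// ler_wpM2l ?mulr_ge0//.
  by case/andP: (expG t tT).
have aU : admissible U.
  split.
  - move=> e e0; have e4 : 0 < e / 4 by rewrite divr_gt0.
    have [n Bn] := geometric_small B0 e4.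
    have e2 : 0 < e / 2 by rewrite divr_gt0.
    have [un _ _] := au n; have [K K0 uK] := un _ e2; exists K => // s s' x x' sT s'T.
    have := uK s s' x x' sT s'T; have := uU n s x sT; have := uU n s' x' s'T.
    have := frob_tri (u n s x) (U s x) (U s' x').
    have := frob_tri (u n s' x') (u n s x) (U s' x').
    have := frobBC (U s x) (u n s x); lra.
  - move=> t x tT; apply/ler_addgt0Pr => e e0.
    have [n Bn] := geometric_small B0 e0; have := uU n t x tT.
    case: (au n) => _ bn _; have := bn t x tT.
    have := frob_le_add (U t x) (u n t x); rewrite (frobBC (U t x)); lra.
  - move=> t tT x k; apply/matrixP => i j; rewrite !mxE; congr glim.
    by apply/funext => n; case: (au n) => _ _ pn; rewrite (pn t tT).
exists U => // t x tT.
apply/eqP; rewrite eq_sym -subr_eq0; apply/eqP/frob_eq0/eqP.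
rewrite eq_le frob_ge0 andbT.
(* The residual picard U - U is compared through picard (u n), which is u n.+1: contraction gives
   the share G / 2, convergence of the iterates the share 1. *)
apply: (@geometric_le0 _ (B * (G / 2 + 1))); first by rewrite mulr_ge0// addr_ge0// divr_ge0.
move=> n; have Bn0 : 0 <= B / 2 ^+ n by rewrite divr_ge0 ?exprn_ge0.
have H1 : frob (picard U t x - picard (u n) t x) <= B / 2 ^+ n / 2 * expR (lam * t).
  apply: (picard_contraction _ eps_gt0 m2_gt0 kappaP aU (au n)) => // s y sT.
  rewrite frobBC; apply: le_trans (uU n s y sT) _.
  by rewrite ler_peMr//; case/andP: (expG s sT).
have H2 : B / 2 ^+ n / 2 * expR (lam * t) <= B / 2 ^+ n / 2 * G.
  by rewrite ler_wpM2l ?divr_ge0//; case/andP: (expG t tT).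
have H3 : frob (picard (u n) t x - U t x) <= B / 2 ^+ n.
  apply: le_trans (uU n.+1 t x tT) _.
  rewrite ler_wpM2l// lef_pV2 ?posrE ?exprn_gt0// exprS ler_peMl ?exprn_ge0//.
  by rewrite ler1n.
apply: le_trans (frob_tri (picard (u n) t x) _ _) _.
rewrite (_ : B * (G / 2 + 1) / 2 ^+ n = B / 2 ^+ n / 2 * G + B / 2 ^+ n); last by ring.
exact: lerD (le_trans H1 H2) H3.
Qed.

End Existence.

Theorem theorem2p3 (R : realType) (d m1 m2 : nat) (a L : 'rV[R]_d)
  (eps T kappa : R) (U0 : 'rV[R]_d -> 'M[R]_(m1, m2)) :
  (1 <= d <= 3)%N ->
  (forall k, 0 < L 0 k) ->
  (1 <= m2)%N -> (m2 <= m1)%N ->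
  0 < eps -> 0 < T -> (3 * m2 + 1)%:R <= kappa ->
  inXm a L U0 ->
  exists U : R -> 'rV[R]_d -> 'M[R]_(m1, m2),
    (in_CXm a L T U /\ mild_solution eps kappa T U0 U /\
     (forall t x, 0 <= t <= T -> box_closure a L x ->
        frob (U t x) <= Num.sqrt (m2%:R))) /\
    (forall V : R -> 'rV[R]_d -> 'M[R]_(m1, m2),
       in_CXm a L T V -> mild_solution eps kappa T U0 V ->
       forall t x, 0 <= t <= T -> V t x = U t x).
Proof.
move=> _ L_gt0 m2_gt0 _ eps_gt0 T_gt0 kappaP XU0.
(* Viewing U0 as a constant path lets the uniform continuity and the global bound for paths serve
   for the initial datum as well. *)
have C0 : in_CXm a L T (fun=> U0).
  split=> [//|t tT e e0]; exists 1 => // s sT _ x _.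
  by rewrite subrr frob0.
have [U aU fU] := fixed_point_exists eps_gt0 T_gt0 m2_gt0 kappaP
  (in_CXm_admissible L_gt0 C0).
exists U; split; first split.
- exact: admissible_in_CXm.
- split; first by move=> t tT x; exact: fU.
  by move=> t x tT _; case: aU => _ bU _; exact: bU.
- move=> V CV mV.
  apply: (fixed_point_unique eps_gt0 m2_gt0 kappaP aU
    (in_CXm_admissible L_gt0 CV) fU).
  by move=> t x tT; exact: mV.
Qed.
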